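(* Let $n\ge 2$, $k\ge 1$, let $(\tilde M,\tilde g)$ be a Riemannian manifold with $\dim\tilde M=n+k$, and let $M\hookrightarrow\tilde M$ be an embedded submanifold with $\dim M=n$. Let $v$ be a vector field on $M$, $p\in M$, and let $v$ be extended to a neighborhood of $p$ in $\tilde M$ (extension still denoted $v$). Then, evaluating at $p$, $$\tilde\nabla^*\tilde\nabla v=\nabla^*\nabla v+\sum_{l=1}^kW_{N_l}W_{N_l}v-nW_{\mathbf H}v+n[\mathbf H,v]-\sum_{l=1}^k\tilde\nabla_{N_l}\tilde\nabla_{N_l}v+\sum_{l=1}^k\tilde\nabla_{\tilde\nabla_{N_l}N_l}v-2\delta^{ij}\mathrm{II}(E_i,\nabla_{E_j}v)-\delta^{ij}(\tilde R(E_j,v)E_i)^\perp,$$ or equivalently $$\tilde\nabla^*\tilde\nabla v=\nabla^*\nabla v+\sum_{l=1}^kW_{N_l}W_{N_l}v+n\tilde\nabla_{\mathbf H}v-\sum_{l=1}^k\tilde\nabla_{N_l}\tilde\nabla_{N_l}v+\sum_{l=1}^k\tilde\nabla_{\tilde\nabla_{N_l}N_l}v-(\operatorname{tr}\nabla^B\mathrm{II})(v)-2\delta^{ij}\mathrm{II}(E_i,\nabla_{E_j}v).$$ In the case of a hypersurface ($k=1$), the first formula reduces to $$\tilde\nabla^*\tilde\nabla v=\nabla^*\nabla v+s^2v+nH\tilde\nabla_Nv-\tilde\nabla_N\tilde\nabla_Nv+\nabla_{\tilde\nabla_NN}v-\Big(2\sum_i\kappa_i\nabla_iv^i+nv(H)-h(\tilde\nabla_NN,v)\Big)N+(\widetilde{\mathrm{Ric}}\,v)^\perp,$$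 and the second to $$\tilde\nabla^*\tilde\nabla v=\nabla^*\nabla v+s^2v+nH\tilde\nabla_Nv-\tilde\nabla_N\tilde\nabla_Nv+\nabla_{\tilde\nabla_NN}v-\Big((\operatorname{div}h)(v)+2\sum_i\kappa_i\nabla_iv^i-h(\tilde\nabla_NN,v)\Big)N.$$
   Context: Everything is smooth. $M$ carries the induced metric $g$; $\tilde\nabla,\nabla$ are the Levi-Civita connections of $\tilde M,M$. ${}^T$ and ${}^\perp$ denote orthogonal projections of $T_p\tilde M$ onto $T_pM$ and the normal space $N_pM=(T_pM)^\perp$. Frames: $E_1,\dots,E_n$ is a local orthonormal (ON) frame on $M$ near $p$ and $N_1,\dots,N_k$ a local ON frame of the normal bundle near $p$, extended so that $E_1,\dots,E_n,N_1,\dots,N_k$ is an ON frame of $\tilde M$ in a neighborhood of $p$. For $k\ge2$, $\{E_i\}$ is arbitrary; for $k=1$, $N=N_1$ is a choice of unit normal and $\{E_i\}$ is chosen so that the $E_i$ at $p$ are eigenvectors of the shape operator. Indices $i,j$ run over $1,\dots,n$; repeated indices are summed. Second fundamental form: $\mathrm{II}(X,Y)=(\tilde\nabla_XY)^\perp$. Weingarten map of a normal field $\eta$: $g(W_\eta X,Y)=\tilde g(\eta,\mathrm{II}(X,Y))$, i.e. $W_\eta X=-(\tilde\nabla_X\eta)^T$. Mean curvature vector: $\mathbf H=\frac1n\delta^{ij}\mathrm{II}(E_i,E_j)$. (In $[\mathbf H,v]$, $\mathbf H$ is extended to a neighborhood of $p$ in $\tilde M$.) Normal connection: $\nabla^\perp_X\eta=(\tilde\nabla_X\eta)^\perp$.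 Connection on normal-bundle-valued bilinear maps $A$ on $TM$: $(\nabla^B_XA)(Y,Z)=\nabla^\perp_X(A(Y,Z))-A(\nabla_XY,Z)-A(Y,\nabla_XZ)$; $(\operatorname{tr}\nabla^B\mathrm{II})(v)=\delta^{ij}(\nabla^B_{E_i}\mathrm{II})(E_j,v)$. For $k=1$: $h(X,Y)=\tilde g(N,\mathrm{II}(X,Y))$; the shape operator $s$ is given by $g(sX,Y)=h(X,Y)$, so $sX=-\tilde\nabla_XN$; $\kappa_i$ are its eigenvalues at $p$ (principal curvatures, $sE_i=\kappa_iE_i$ at $p$); $H=\frac1n\sum_i\kappa_i$ is the mean curvature, so $\mathbf H=HN$; $(\operatorname{div}h)(v)=\sum_i(\nabla_{E_i}h)(E_i,v)$. $\nabla_iv^j=E_i(v^j)+\Gamma^j_{ik}v^k$, where $\nabla_{E_i}E_k=\Gamma_{ik}^jE_j$; thus $\nabla_iv^i$ (fixed $i$) equals $g(\nabla_{E_i}v,E_i)$. Bochner Laplacian on a Riemannian manifold with local ON frame $\{F_a\}$ and Levi-Civita connection $D$: $D^*Dv=-\operatorname{div}Dv=-\sum_a(D_{F_a}D_{F_a}v-D_{D_{F_a}F_a}v)$; $\nabla^*\nabla$ is that of $M$, $\tilde\nabla^*\tilde\nabla$ that of $\tilde M$. Curvature convention: $\tilde R(X,Y)Z=\tilde\nabla_X\tilde\nabla_YZ-\tilde\nabla_Y\tilde\nabla_XZ-\tilde\nabla_{[X,Y]}Z$, $\tilde R(W,X,Y,Z)=\tilde g(\tilde R(W,X)Y,Z)$;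 $\widetilde{\mathrm{Ric}}(X,Y)=\sum_\alpha\tilde R(E_\alpha,X,Y,E_\alpha)$ over an ON frame $\{E_\alpha\}$ of $\tilde M$, and $\widetilde{\mathrm{Ric}}\,v=\widetilde{\mathrm{Ric}}(v,\cdot)^\sharp$. *)

(* Defs.v *)
From HB Require Import structures.
From mathcomp Require Import all_boot all_order all_algebra.
From mathcomp Require Import all_classical all_reals all_analysis.
Import Order.TTheory GRing.Theory Num.Theory numFieldNormedType.Exports.

Set Implicit Arguments.
Unset Strict Implicit.
Unset Printing Implicit Defensive.

Local Open Scope classical_set_scope.
Local Open Scope ring_scope.

(* Smooth functions, tangent vectors and smooth maps follow F. Warner,
   "Foundations of Differentiable Manifolds and Lie Groups", Chapter 1:
   tangent vectors are derivations of germs of smooth functions, and a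
   continuous map is smooth when it pulls smooth local functions back to
   smooth local functions. *)

(* All iterated partial derivatives of order r exist on O, and those of order
   exactly r are continuous there. *)
Fixpoint C_order {R : realType} {m : nat} (r : nat) (O : set 'rV[R]_m)
    (f : 'rV[R]_m -> R) : Prop :=
  match r with
  | 0 => forall x, O x -> {for x, continuous f}
  | r'.+1 => forall i : 'I_m,
      (forall x, O x -> derivable f x (delta_mx 0 i)) /\
      C_order r' O ('D_(delta_mx 0 i) f)
  end.

Definition C_infty {R : realType} {m : nat} (O : set 'rV[R]_m)
    (f : 'rV[R]_m -> R) : Prop :=
  forall r, C_order r O f.

Record chart (R : realType) (m : nat) (T : topologicalType) := Chart {
  chart_dom : set T;
  chart_map :> T -> 'rV[R]_m;
  chart_inv : 'rV[R]_m -> T;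
  chart_dom_open : open chart_dom;
  chart_img_open : open (chart_map @` chart_dom);
  chart_mapK : forall q, chart_dom q -> chart_inv (chart_map q) = q;
  chart_map_continuous : forall q, chart_dom q -> {for q, continuous chart_map};
  chart_inv_continuous : forall x, (chart_map @` chart_dom) x ->
    {for x, continuous chart_inv}
}.

Record manifold (R : realType) (m : nat) := Manifold {
  carrier :> topologicalType;
  atlas : set (chart R m carrier);
  manifold_hausdorff : hausdorff_space carrier;
  manifold_second_countable : @second_countable carrier;
  atlas_cover : forall q, exists2 c, atlas c & chart_dom c q;
  atlas_compatible : forall c c', atlas c -> atlas c' -> forall i : 'I_m,
    C_infty (c @` (chart_dom c `&` chart_dom c'))
            (fun x => c' (chart_inv c x) 0 i)
}.

(* f is smooth on some neighbourhood of p. *)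
Definition smooth_at {R : realType} {m : nat} {M : manifold R m} (p : M)
    (f : M -> R) : Prop :=
  exists U : set M, [/\ open U, U p &
    forall c, atlas c ->
      C_infty (c @` (U `&` chart_dom c)) (fun x => f (chart_inv c x))].

(* Tangent vectors are represented inside the R-module of all functionals on
   M -> R; T_p M is the submodule of those that are derivations of germs at p.
   The first clause fixes the (irrelevant) value on functions that are not
   smooth near p, so that equality of tangent vectors is equality of
   functionals. *)
Notation vec R M := ((M -> R) -> R) (only parsing).
Notation vfield R M := (M -> (M -> R) -> R) (only parsing).

Definition tangent {R : realType} {m : nat} {M : manifold R m} (p : M)
    (x : vec R M) : Prop :=
  [/\ forall f, ~ smooth_at p f -> x f = 0,
      forall f f', smooth_at p f -> smooth_at p f' ->
        (\forall q \near p, f q = f' q) -> x f = x f',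
      forall (a : R) f f', smooth_at p f -> smooth_at p f' ->
        x (fun q => a * f q + f' q) = a * x f + x f' &
      forall f f', smooth_at p f -> smooth_at p f' ->
        x (fun q => f q * f' q) = x f * f' p + f p * x f'].

(* X is a smooth vector field on some neighbourhood of p. *)
Definition smooth_field_at {R : realType} {m : nat} {M : manifold R m} (p : M)
    (X : vfield R M) : Prop :=
  (\forall q \near p, tangent q (X q)) /\
  (forall f, smooth_at p f -> smooth_at p (fun q => X q f)).

Definition lie_bracket {R : realType} {m : nat} {M : manifold R m}
    (X Y : vfield R M) : vfield R M :=
  fun p f => if `[< smooth_at p f >]
             then X p (fun q => Y q f) - Y p (fun q => X q f) else 0.

(* Only the restriction of g p to T_p M is meaningful. *)
Definition riemannian_metric {R : realType} {m : nat} {M : manifold R m}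
    (g : M -> vec R M -> vec R M -> R) : Prop :=
  [/\ forall p x y, tangent p x -> tangent p y -> g p x y = g p y x,
      forall p (a : R) x y z, tangent p x -> tangent p y -> tangent p z ->
        g p (a *: x + y) z = a * g p x z + g p y z,
      forall p x, tangent p x -> x != 0 -> 0 < g p x x &
      forall p X Y, smooth_field_at p X -> smooth_field_at p Y ->
        smooth_at p (fun q => g q (X q) (Y q))].

(* A connection acts on germs of vector fields: D p x Y is the derivative at p,
   in the direction x in T_p M, of a vector field Y smooth near p. *)
Definition connection {R : realType} {m : nat} {M : manifold R m}
    (D : M -> vec R M -> vfield R M -> vec R M) : Prop :=
  [/\ forall p x Y, tangent p x -> smooth_field_at p Y -> tangent p (D p x Y),
      forall p x Y Y', tangent p x -> smooth_field_at p Y ->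
        smooth_field_at p Y' -> (\forall q \near p, Y q = Y' q) ->
        D p x Y = D p x Y',
      forall p X Y, smooth_field_at p X -> smooth_field_at p Y ->
        smooth_field_at p (fun q => D q (X q) Y),
      forall p (a : R) x y Y, tangent p x -> tangent p y ->
        smooth_field_at p Y -> D p (a *: x + y) Y = a *: D p x Y + D p y Y &
      (forall p x Y Y', tangent p x -> smooth_field_at p Y ->
        smooth_field_at p Y' ->
        D p x (fun q => Y q + Y' q) = D p x Y + D p x Y') /\
      (forall p x f Y, tangent p x -> smooth_at p f -> smooth_field_at p Y ->
        D p x (fun q => f q *: Y q) = x f *: Y p + f p *: D p x Y)].

Definition cov {R : realType} {m : nat} {M : manifold R m}
    (D : M -> vec R M -> vfield R M -> vec R M) (X Y : vfield R M) :
    vfield R M :=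
  fun q => D q (X q) Y.

Definition levi_civita {R : realType} {m : nat} {M : manifold R m}
    (g : M -> vec R M -> vec R M -> R)
    (D : M -> vec R M -> vfield R M -> vec R M) : Prop :=
  [/\ connection D,
      forall p X Y, smooth_field_at p X -> smooth_field_at p Y ->
        cov D X Y p - cov D Y X p = lie_bracket X Y p &
      forall p x Y Z, tangent p x -> smooth_field_at p Y ->
        smooth_field_at p Z ->
        x (fun q => g q (Y q) (Z q)) = g p (D p x Y) (Z p) + g p (Y p) (D p x Z)].

Definition on_basis {R : realType} {m r : nat} {M : manifold R m}
    (g : M -> vec R M -> vec R M -> R) (q : M) (e : 'I_r -> vec R M) : Prop :=
  [/\ forall i, tangent q (e i),
      forall i j, g q (e i) (e j) = (i == j)%:R &
      forall x, tangent q x -> exists c : 'I_r -> R, x = \sum_i c i *: e i].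

Definition on_frame {R : realType} {m r : nat} {M : manifold R m}
    (g : M -> vec R M -> vec R M -> R) (p : M) (F : 'I_r -> vfield R M) : Prop :=
  (forall i, smooth_field_at p (F i)) /\
  \forall q \near p, on_basis g q (F ^~ q).

Definition bochner_laplacian {R : realType} {m r : nat} {M : manifold R m}
    (D : M -> vec R M -> vfield R M -> vec R M) (F : 'I_r -> vfield R M)
    (X : vfield R M) : vfield R M :=
  fun p => - \sum_a (cov D (F a) (cov D (F a) X) p
                     - cov D (cov D (F a) (F a)) X p).

Definition curvature {R : realType} {m : nat} {M : manifold R m}
    (D : M -> vec R M -> vfield R M -> vec R M) (X Y Z : vfield R M) :
    vfield R M :=
  fun p => cov D X (cov D Y Z) p - cov D Y (cov D X Z) p
           - cov D (lie_bracket X Y) Z p.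

Definition ricci {R : realType} {m r : nat} {M : manifold R m}
    (g : M -> vec R M -> vec R M -> R)
    (D : M -> vec R M -> vfield R M -> vec R M) (F : 'I_r -> vfield R M)
    (X Y : vfield R M) (p : M) : R :=
  \sum_a g p (curvature D (F a) X Y p) (F a p).

(* The vector w of T_p M with g_p(w, Y_p) = om(Y) for all local fields Y. *)
Definition sharp {R : realType} {m : nat} {M : manifold R m}
    (g : M -> vec R M -> vec R M -> R) (p : M) (om : vfield R M -> R) :
    vec R M :=
  xget 0 [set w | tangent p w /\
                  forall Y, smooth_field_at p Y -> g p w (Y p) = om Y].

(* The i-th partial covariant derivative of the j-th component of v in an
   orthonormal frame E, where v^j = g(v, E_j) and
   Gamma_ik^j = g(nabla_{E_i} E_k, E_j). *)
Definition cov_component {R : realType} {m r : nat} {M : manifold R m}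
    (g : M -> vec R M -> vec R M -> R)
    (D : M -> vec R M -> vfield R M -> vec R M) (E : 'I_r -> vfield R M)
    (v : vfield R M) (p : M) (i j : 'I_r) : R :=
  E i p (fun q => g q (v q) (E j q))
  + \sum_k g p (cov D (E i) (E k) p) (E j p) * g p (v p) (E k p).

Definition differential {R : realType} {m m' : nat} {M : manifold R m}
    {M' : manifold R m'} (iota : M -> M') (p : M) (x : vec R M) : vec R M' :=
  fun f => if `[< smooth_at (iota p) f >] then x (fun q => f (iota q)) else 0.

Definition smooth_map {R : realType} {m m' : nat} {M : manifold R m}
    {M' : manifold R m'} (iota : M -> M') : Prop :=
  continuous iota /\
  forall p f, smooth_at (iota p) f -> smooth_at p (fun q => f (iota q)).

(* The fourth clause says that the topology of M is induced by iota, i.e. that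
   iota is a homeomorphism onto its image. *)
Definition embedding {R : realType} {m m' : nat} {M : manifold R m}
    {M' : manifold R m'} (iota : M -> M') : Prop :=
  [/\ smooth_map iota,
      forall p x y, tangent p x -> tangent p y ->
        differential iota p x = differential iota p y -> x = y,
      injective iota &
      forall U : set M, open U -> exists2 V : set M', open V & U = iota @^-1` V].

Definition induced_metric {R : realType} {m m' : nat} {M : manifold R m}
    {M' : manifold R m'} (gt : M' -> vec R M' -> vec R M' -> R)
    (iota : M -> M') : M -> vec R M -> vec R M -> R :=
  fun p x y => gt (iota p) (differential iota p x) (differential iota p y).

(* Vt is an extension to a neighbourhood of iota p of V, given along M. *)
Definition extends_at {R : realType} {m m' : nat} {M : manifold R m}
    {M' : manifold R m'} (iota : M -> M') (p : M) (Vt : vfield R M')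
    (V : M -> vec R M') : Prop :=
  smooth_field_at (iota p) Vt /\ \forall q \near p, Vt (iota q) = V q.

(* The orthogonal projection T_p M' -> T_p M, with values in T_p M. *)
Definition tangential_part {R : realType} {m m' : nat} {M : manifold R m}
    {M' : manifold R m'} (gt : M' -> vec R M' -> vec R M' -> R)
    (iota : M -> M') (p : M) (z : vec R M') : vec R M :=
  xget 0 [set y | tangent p y /\ forall x, tangent p x ->
    gt (iota p) (z - differential iota p y) (differential iota p x) = 0].

Definition normal_part {R : realType} {m m' : nat} {M : manifold R m}
    {M' : manifold R m'} (gt : M' -> vec R M' -> vec R M' -> R)
    (iota : M -> M') (p : M) (z : vec R M') : vec R M' :=
  z - differential iota p (tangential_part gt iota p z).

Definition normal_space {R : realType} {m m' : nat} {M : manifold R m}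
    {M' : manifold R m'} (gt : M' -> vec R M' -> vec R M' -> R)
    (iota : M -> M') (p : M) (z : vec R M') : Prop :=
  tangent (iota p) z /\
  forall x, tangent p x -> gt (iota p) z (differential iota p x) = 0.

Definition on_normal_basis {R : realType} {m m' r : nat} {M : manifold R m}
    {M' : manifold R m'} (gt : M' -> vec R M' -> vec R M' -> R)
    (iota : M -> M') (q : M) (e : 'I_r -> vec R M') : Prop :=
  [/\ forall l, normal_space gt iota q (e l),
      forall l l', gt (iota q) (e l) (e l') = (l == l')%:R &
      forall z, normal_space gt iota q z ->
        exists c : 'I_r -> R, z = \sum_l c l *: e l].

(* A local vector field of M' that is tangent to M along M and takes the value
   y in T_p M at p. *)
Definition tangent_extension {R : realType} {m m' : nat} {M : manifold R m}
    {M' : manifold R m'} (iota : M -> M') (p : M) (y : vec R M) : vfield R M' :=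
  xget 0 [set Y | [/\ smooth_field_at (iota p) Y,
    Y (iota p) = differential iota p y &
    \forall q \near p,
      exists2 x, tangent q x & Y (iota q) = differential iota q x]].

(* II_p(x, y) = (D'_x Y)^perp, which depends only on y = Y_p among the fields Y
   that are tangent to M along M. *)
Definition second_ff {R : realType} {m m' : nat} {M : manifold R m}
    {M' : manifold R m'} (gt : M' -> vec R M' -> vec R M' -> R)
    (Dt : M' -> vec R M' -> vfield R M' -> vec R M')
    (iota : M -> M') (p : M) (x y : vec R M) : vec R M' :=
  normal_part gt iota p
    (Dt (iota p) (differential iota p x) (tangent_extension iota p y)).

Definition weingarten {R : realType} {m m' : nat} {M : manifold R m}
    {M' : manifold R m'} (gt : M' -> vec R M' -> vec R M' -> R)
    (Dt : M' -> vec R M' -> vfield R M' -> vec R M')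
    (iota : M -> M') (p : M) (eta : vec R M') (x : vec R M) : vec R M :=
  sharp (induced_metric gt iota) p
    (fun Y => gt (iota p) eta (second_ff gt Dt iota p x (Y p))).

Definition mean_curvature_vector {R : realType} {m m' r : nat}
    {M : manifold R m} {M' : manifold R m'}
    (gt : M' -> vec R M' -> vec R M' -> R)
    (Dt : M' -> vec R M' -> vfield R M' -> vec R M')
    (iota : M -> M') (E : 'I_r -> vfield R M) (q : M) : vec R M' :=
  r%:R^-1 *: \sum_i second_ff gt Dt iota q (E i q) (E i q).

(* The derivative D'_x eta of a field eta given along M only is that of any
   local extension of eta to M'. *)
Definition normal_connection {R : realType} {m m' : nat} {M : manifold R m}
    {M' : manifold R m'} (gt : M' -> vec R M' -> vec R M' -> R)
    (Dt : M' -> vec R M' -> vfield R M' -> vec R M')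
    (iota : M -> M') (p : M) (x : vec R M) (eta : M -> vec R M') : vec R M' :=
  normal_part gt iota p
    (Dt (iota p) (differential iota p x)
        (xget 0 [set Y | extends_at iota p Y eta])).

Definition nablaB {R : realType} {m m' : nat} {M : manifold R m}
    {M' : manifold R m'} (gt : M' -> vec R M' -> vec R M' -> R)
    (Dt : M' -> vec R M' -> vfield R M' -> vec R M')
    (iota : M -> M') (D : M -> vec R M -> vfield R M -> vec R M)
    (A : M -> vec R M -> vec R M -> vec R M') (X Y Z : vfield R M) (p : M) :
    vec R M' :=
  normal_connection gt Dt iota p (X p) (fun q => A q (Y q) (Z q))
  - A p (cov D X Y p) (Z p) - A p (Y p) (cov D X Z p).

Definition tr_nablaB {R : realType} {m m' r : nat} {M : manifold R m}
    {M' : manifold R m'} (gt : M' -> vec R M' -> vec R M' -> R)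
    (Dt : M' -> vec R M' -> vfield R M' -> vec R M')
    (iota : M -> M') (D : M -> vec R M -> vfield R M -> vec R M)
    (A : M -> vec R M -> vec R M -> vec R M') (E : 'I_r -> vfield R M)
    (v : vfield R M) (p : M) : vec R M' :=
  \sum_i nablaB gt Dt iota D A (E i) (E i) v p.

(* Here and in shape_operator, Nu is the unit normal of a hypersurface, extended
   to a neighbourhood in M'. *)
Definition scalar_ff {R : realType} {m m' : nat} {M : manifold R m}
    {M' : manifold R m'} (gt : M' -> vec R M' -> vec R M' -> R)
    (Dt : M' -> vec R M' -> vfield R M' -> vec R M')
    (iota : M -> M') (Nu : vfield R M') (q : M) (x y : vec R M) : R :=
  gt (iota q) (Nu (iota q)) (second_ff gt Dt iota q x y).

Definition shape_operator {R : realType} {m m' : nat} {M : manifold R m}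
    {M' : manifold R m'} (gt : M' -> vec R M' -> vec R M' -> R)
    (Dt : M' -> vec R M' -> vfield R M' -> vec R M')
    (iota : M -> M') (Nu : vfield R M') (q : M) (x : vec R M) : vec R M :=
  sharp (induced_metric gt iota) q
    (fun Y => scalar_ff gt Dt iota Nu q x (Y q)).

(* H is the mean of the eigenvalues, counted with multiplicity, of the
   self-adjoint operator s on the m-dimensional space T_q M. *)
Definition is_mean_curvature {R : realType} {m : nat} {M : manifold R m}
    (g : M -> vec R M -> vec R M -> R) (q : M) (s : vec R M -> vec R M)
    (H : R) : Prop :=
  exists (e : 'I_m -> vec R M) (kappa : 'I_m -> R),
    [/\ on_basis g q e,
        forall i, s (e i) = kappa i *: e i &
        H = m%:R^-1 * \sum_i kappa i].

Definition div_form {R : realType} {m r : nat} {M : manifold R m}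
    (D : M -> vec R M -> vfield R M -> vec R M)
    (h : M -> vec R M -> vec R M -> R) (E : 'I_r -> vfield R M)
    (v : vfield R M) (p : M) : R :=
  \sum_i (E i p (fun q => h q (E i q) (v q))
          - h p (cov D (E i) (E i) p) (v p)
          - h p (E i p) (cov D (E i) v p)).

(* Main.v *)
Require Import Defs.
From HB Require Import structures.
From mathcomp Require Import all_boot all_order all_algebra.
From mathcomp Require Import all_classical all_reals all_analysis.
From mathcomp Require Import ring.
Import Order.TTheory GRing.Theory Num.Theory numFieldNormedType.Exports.
Set Implicit Arguments.
Unset Strict Implicit.
Unset Printing Implicit Defensive.
Local Open Scope classical_set_scope.
Local Open Scope ring_scope.

(** Why the formulas hold. All Bochner Laplacians are minus traces of the second
    covariant derivative hess(X, Y)v = D_X D_Y v - D_{D_X Y} v, which is tensorial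
    in X and Y; so they may be computed in the frame E_1, ..., E_n, N_1, ..., N_k
    adapted to M (bochner_laplacian_frame). The normal directions contribute the
    terms in N_l as they stand. In a tangential direction, the Gauss formula
    Dt_X Y = D_X Y + II(X, Y) (gauss_formula) is differentiated a second time
    (second_derivative): D_X Y gives D_X D_X Y + II(X, D_X Y), and the normal field
    II(X, Y) gives its normal derivative and, by the Weingarten formula
    (weingarten_formula), the tangential term - W_{II(X, Y)} X. Summing over the
    frame, the latter terms make up the squares of the W_{N_l}
    (sum_weingarten_second_ff), the normal derivatives make up the trace of the
    covariant derivative of II, and the normal part of Dt_{E_i} E_i makes up n H.
    This is the second formula (sum_hess_tangential). The first one follows from
    the Codazzi equation (codazzi), traced over the frame (tr_nablaB_codazzi), and
    from [H, v] = Dt_H v - Dt_v H with the Weingarten formula for Dt_v H. For a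
    hypersurface the unit normal is parallel in the normal bundle
    (hypersurface_normal_connection), so normal derivatives become derivatives
    of coefficients, and the curvature term is a Ricci term because the curvature
    operator is skew-adjoint (normal_part_ricci).

    Two points are specific to tangent vectors as derivations of germs. First, a
    field smooth at p has to be smooth at the points near p. This follows from its
    expression in coordinate fields. That these span the tangent spaces is
    deduced from the existence of orthonormal frames with as many members as the
    dimension (spanned_coord), and that they are smooth in every chart from the
    inversion of the Jacobian matrix (smooth_coord_vec). Secondly, II, the normal
    connection and the projections are defined by choosing an extension or a
    preimage. Each is therefore first given by a formula in the adapted frame:
    for II, the formula II(x, y) = - sum_l gt(y, Dt_x N_l) N_l, which does not
    extend y (second_ffE); for the normal connection, the independence of
    Dt_x Y from the values of Y off the submanifold (ambient_conn_along). *)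

(** * Smooth functions on open subsets of coordinate space *)

Section SmoothCoordinateFunctions.
Context {R : realType} {m : nat}.
Implicit Types (O : set 'rV[R]_m) (f g : 'rV[R]_m -> R) (r : nat).

(** The partial derivatives of a function outside O are unconstrained, so that all
    rules of calculus on O rest on this congruence. *)
Lemma C_order_ext r O f g : open O -> (forall x, O x -> f x = g x) ->
  C_order r O f -> C_order r O g.
Proof.
move=> oO; have near_fg f' g' x : (forall x, O x -> f' x = g' x) -> O x ->
    \forall y \near x, f' y = g' y.
  by move=> e Ox; apply: filterS (open_nbhs_nbhs (conj oO Ox)) => y; exact: e.
elim: r f g => [|r IH] f g fg /= Cf.
  move=> x Ox; have fgx := near_fg _ _ _ fg Ox.
  change (g @ x --> g x); rewrite -(fg _ Ox); apply: cvg_trans (Cf x Ox).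
  exact: (@near_eq_cvg _ _ (nbhs x) _ f g fgx).
move=> i; have [df Cd] := Cf i; split=> [x Ox|].
  by apply: near_eq_derivable (df x Ox); exact: near_fg.
by apply: IH Cd => x Ox; apply: near_eq_derive; exact: near_fg.
Unshelve. all: by end_near. Qed.

Lemma C_order_sub r O O' f : O' `<=` O -> C_order r O f -> C_order r O' f.
Proof.
move=> sO; elim: r f => [|r IH] f /= Cf; first by move=> x /sO; exact: Cf.
move=> i; have [df Cd] := Cf i.
by split=> [x /sO|]; [exact: df|exact: IH].
Qed.

Lemma C_infty_ext O f g : open O -> (forall x, O x -> f x = g x) ->
  C_infty O f -> C_infty O g.
Proof. by move=> oO fg Cf r; apply: C_order_ext (Cf r). Qed.

Lemma C_infty_sub O O' f : O' `<=` O -> C_infty O f -> C_infty O' f.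
Proof. by move=> sO Cf r; apply: C_order_sub (Cf r). Qed.

Lemma C_infty_derivable O f x i : C_infty O f -> O x ->
  derivable f x (delta_mx 0 i).
Proof. by move=> Cf; have [+ _] := Cf 1%N i; apply. Qed.

Lemma C_infty_derive O f i : C_infty O f -> C_infty O ('D_(delta_mx 0 i) f).
Proof. by move=> Cf r; have [_] := Cf r.+1 i. Qed.

Lemma C_order_cst r O (a : R) : C_order r O (cst a).
Proof.
elim: r a => [|r IH] a /= => [x _|i]; first exact: cst_continuous.
split=> [x _|]; first exact: derivable_cst.
have -> : 'D_(delta_mx 0 i) (cst a) = cst (0 : R) :> ('rV[R]_m -> R) => //.
by apply/funext => x; rewrite derive_cst.
Qed.

Lemma C_orderD r O f g : open O -> C_order r O f -> C_order r O g ->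
  C_order r O (fun x => f x + g x).
Proof.
move=> oO; elim: r f g => [|r IH] f g /= Cf Cg.
  by move=> x Ox; exact: (cvgD (Cf x Ox) (Cg x Ox)).
move=> i; have [df Cdf] := Cf i; have [dg Cdg] := Cg i.
split=> [x Ox|]; first by apply: derivableD; [exact: df|exact: dg].
apply: (C_order_ext oO _ (IH _ _ Cdf Cdg)) => x Ox.
by rewrite -deriveD; [|exact: df|exact: dg].
Qed.

(** The product rule raises orders of differentiation on both factors, so that
    the induction needs every order up to r on each of them. *)
Lemma C_orderM r O f g : open O ->
  (forall s, (s <= r)%N -> C_order s O f) ->
  (forall s, (s <= r)%N -> C_order s O g) ->
  C_order r O (fun x => f x * g x).
Proof.
move=> oO; elim: r f g => [|r IH] f g Cf Cg /=.
  by move=> x Ox; exact: (cvgM (Cf 0%N isT x Ox) (Cg 0%N isT x Ox)).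
move=> i; have [df _] := Cf 1%N isT i; have [dg _] := Cg 1%N isT i.
split=> [x Ox|]; first by apply: derivableM; [exact: df|exact: dg].
have Cfg : C_order r O (fun x => f x * 'D_(delta_mx 0 i) g x).
  apply: IH => s sr; first by apply: Cf; exact: leqW.
  by have [_] := Cg s.+1 sr i.
have Cgf : C_order r O (fun x => g x * 'D_(delta_mx 0 i) f x).
  apply: IH => s sr; first by apply: Cg; exact: leqW.
  by have [_] := Cf s.+1 sr i.
apply: (C_order_ext oO _ (C_orderD oO Cfg Cgf)) => x Ox.
by rewrite -[RHS]/('D_(delta_mx 0 i) (f * g) x) deriveM; [|exact: df|exact: dg].
Qed.

Lemma C_inftyD O f g : open O -> C_infty O f -> C_infty O g ->
  C_infty O (fun x => f x + g x).
Proof. by move=> oO Cf Cg r; apply: C_orderD. Qed.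

Lemma C_inftyM O f g : open O -> C_infty O f -> C_infty O g ->
  C_infty O (fun x => f x * g x).
Proof. by move=> oO Cf Cg r; apply: C_orderM => // s _. Qed.

Lemma C_inftyV O f : open O -> (forall x, O x -> f x != 0) -> C_infty O f ->
  C_infty O (fun x => (f x)^-1).
Proof.
move=> oO f0 Cf r; suff H s : (s <= r)%N -> C_order s O (fun x => (f x)^-1).
  exact: H.
elim: r s => [|r IH] s.
  rewrite leqn0 => /eqP -> /= x Ox; exact: (cvgV (f0 x Ox) (Cf 0%N x Ox)).
rewrite leq_eqVlt => /orP[/eqP -> /=|]; last exact: IH.
move=> i; split=> [x Ox|].
  by apply: derivableV; [exact: f0|exact: C_infty_derivable Ox].
(* (1/f)' = -(1/f)(1/f)f' involves only the lower orders of 1/f. *)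
have C2 s' : (s' <= r)%N -> C_order s' O (fun x => (f x)^-1 * (f x)^-1).
  by move=> s'r; apply: C_orderM => // t ts; apply: IH; exact: leq_trans ts s'r.
have CN s' : (s' <= r)%N -> C_order s' O (fun x => - 1 * 'D_(delta_mx 0 i) f x).
  move=> _; apply: (C_inftyM oO) => [r'|]; first exact: C_order_cst.
  exact: C_infty_derive.
apply: (C_order_ext oO _ (C_orderM oO C2 CN)) => x Ox.
rewrite deriveV; [|exact: f0|exact: C_infty_derivable Ox].
by rewrite /GRing.scale /= mulN1r mulrN mulNr -exprVn expr2.
Qed.

Lemma derive_coord (x : 'rV[R]_m) i j :
  'D_(delta_mx 0 i) (fun y : 'rV[R]_m => y 0 j) x = (i == j)%:R.
Proof.
apply: cvg_lim => //=.
apply: (@cvg_trans _ ((fun=> (i == j)%:R : R) @ 0^')); last exact: cvg_cst.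
apply: near_eq_cvg; near=> h.
have h0 : h != 0 by near: h; exact: nbhs_dnbhs_neq.
by rewrite /= !mxE eqxx /= addrK /GRing.scale /= mulrA mulVf // mul1r eq_sym.
Unshelve. all: by end_near. Qed.

End SmoothCoordinateFunctions.

(** The entries of an inverse matrix are rational functions of the entries of
    the matrix: a class of functions closed under ring operations and under
    inversion of the determinant contains them. *)
Section MatrixOfFunctions.
Context {R : fieldType} {T : Type} (S : (T -> R) -> Prop).
Hypothesis Scst : forall a, S (fun=> a).
Hypothesis SD : forall f g, S f -> S g -> S (fun x => f x + g x).
Hypothesis SM : forall f g, S f -> S g -> S (fun x => f x * g x).

Lemma closed_sum I (r : seq I) (P : pred I) (f : I -> T -> R) :
  (forall i, S (f i)) -> S (fun x => \sum_(i <- r | P i) f i x).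
Proof.
move=> Sf; elim: r => [|i r IH].
  by rewrite (_ : (fun _ => _) = fun=> 0) //; apply/funext => x; rewrite big_nil.
rewrite (_ : (fun _ => _) = fun x => (if P i then f i x else 0)
    + \sum_(i <- r | P i) f i x); last first.
  by apply/funext => x; rewrite big_cons; case: (P i); rewrite ?add0r.
by apply: SD => //; case: (P i).
Qed.

Lemma closed_prod I (r : seq I) (f : I -> T -> R) :
  (forall i, S (f i)) -> S (fun x => \prod_(i <- r) f i x).
Proof.
move=> Sf; elim: r => [|i r IH].
  by rewrite (_ : (fun _ => _) = fun=> 1) //; apply/funext => x; rewrite big_nil.
rewrite (_ : (fun _ => _) = fun x => f i x * \prod_(i <- r) f i x).
  exact: SM.
by apply/funext => x; rewrite big_cons.
Qed.

Lemma closed_det m (A : T -> 'M[R]_m) :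
  (forall i j, S (fun x => A x i j)) -> S (fun x => \det (A x)).
Proof.
move=> SA; rewrite /determinant; apply: closed_sum => s.
by apply: SM; [exact: Scst|exact: closed_prod].
Qed.

Lemma closed_inv_mx m (A : T -> 'M[R]_m) :
  (forall i j, S (fun x => A x i j)) -> S (fun x => (\det (A x))^-1) ->
  (forall i j, S (fun x => ((\det (A x))^-1 *: \adj (A x)) i j)).
Proof.
move=> SA SV i j.
rewrite (_ : (fun _ => _) = fun x => (\det (A x))^-1 * cofactor (A x) j i).
  apply: SM => //; rewrite /cofactor; apply: SM; first exact: Scst.
  apply: closed_det => i' j'.
  rewrite (_ : (fun _ => _) = fun x => A x (lift j i') (lift i j')) //.
  by apply/funext => x; rewrite !mxE.
by apply/funext => x; rewrite !mxE.
Qed.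

End MatrixOfFunctions.

(** * Germs of smooth functions on a manifold *)

Lemma near_forall_fin (T : topologicalType) (I : finType) (p : T)
    (P : I -> T -> Prop) :
  (forall i, \forall q \near p, P i q) -> \forall q \near p, forall i, P i q.
Proof. by move=> H; apply: filter_forall. Qed.

Lemma open_near (T : topologicalType) (O : set T) (x : T) :
  open O -> O x -> \forall y \near x, O y.
Proof. by move=> oO Ox; apply: open_nbhs_nbhs; split. Qed.

Lemma near_open (T : topologicalType) (P : T -> Prop) (x : T) :
  (\forall y \near x, P y) ->
  exists V : set T, [/\ open V, V x & forall y, V y -> P y].
Proof.
move=> nP; have : nbhs x P by [].
by rewrite nbhsE => -[V [oV Vx] VP]; exists V.
Qed.

Section SmoothFunctions.
Context {R : realType} {m : nat} {M : manifold R m}.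
Implicit Types (p q : M) (f : M -> R) (U : set M) (c : chart R m M).

Lemma chart_open_image c U : open U -> open (c @` (U `&` chart_dom c)).
Proof.
move=> oU; rewrite openE => x [q [Uq cq] <-].
have imcq : (c @` chart_dom c) (c q) by exists q.
have N1 : \forall y \near c q, (c @` chart_dom c) y.
  exact: (open_near (@chart_img_open _ _ _ c) imcq).
have N2 : \forall y \near c q, U (chart_inv c y).
  apply: (@chart_inv_continuous _ _ _ c _ imcq).
  by rewrite chart_mapK //; exact: (open_near oU Uq).
apply: filterS2 N1 N2 => y [q' cq' <-]; rewrite chart_mapK // => Uq'.
by exists q'.
Qed.

Lemma smooth_at_cst p (a : R) : smooth_at p (fun=> a).
Proof.
exists setT; split=> //; first exact: openT.
by move=> c _ r; exact: C_order_cst.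
Qed.

Lemma smooth_at_near p f f' : (\forall q \near p, f q = f' q) ->
  smooth_at p f -> smooth_at p f'.
Proof.
move=> /near_open[V [oV Vp Vf]] [U [oU Up Uf]].
exists (V `&` U); split=> // [|c cA]; first exact: openI.
apply: (C_infty_ext (f := fun x => f (chart_inv c x))).
- by apply: chart_open_image; exact: openI.
- by move=> x [q [[Vq _] cq] <-]; rewrite chart_mapK //; exact: Vf.
- by apply: C_infty_sub (Uf c cA) => x [q [[Vq Uq] cq] <-]; exists q.
Qed.

Lemma smooth_at2 p f f' (op : R -> R -> R) :
  (forall (O : set 'rV[R]_m) g g', open O -> C_infty O g -> C_infty O g' ->
    C_infty O (fun x => op (g x) (g' x))) ->
  smooth_at p f -> smooth_at p f' -> smooth_at p (fun q => op (f q) (f' q)).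
Proof.
move=> Cop [U [oU Up Uf]] [V [oV Vp Vf]].
exists (U `&` V); split=> // [|c cA]; first exact: openI.
apply: Cop; first by apply: chart_open_image; exact: openI.
- by apply: C_infty_sub (Uf c cA) => x [q [[? ?] ?] <-]; exists q.
- by apply: C_infty_sub (Vf c cA) => x [q [[? ?] ?] <-]; exists q.
Qed.

Lemma smooth_atD p f f' : smooth_at p f -> smooth_at p f' ->
  smooth_at p (fun q => f q + f' q).
Proof. by apply: smooth_at2 => O g g'; exact: C_inftyD. Qed.

Lemma smooth_atM p f f' : smooth_at p f -> smooth_at p f' ->
  smooth_at p (fun q => f q * f' q).
Proof. by apply: smooth_at2 => O g g'; exact: C_inftyM. Qed.

Lemma smooth_atV p f : (\forall q \near p, f q != 0) -> smooth_at p f ->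
  smooth_at p (fun q => (f q)^-1).
Proof.
move=> /near_open[V [oV Vp Vf]] [U [oU Up Uf]].
exists (V `&` U); split=> // [|c cA]; first exact: openI.
apply: C_inftyV; first by apply: chart_open_image; exact: openI.
  by move=> x [q [[Vq _] cq] <-]; rewrite chart_mapK //; exact: Vf.
by apply: C_infty_sub (Uf c cA) => x [q [[Vq Uq] cq] <-]; exists q.
Qed.

Lemma smooth_at_sum p (I : Type) (r : seq I) (P : pred I) (f : I -> M -> R) :
  (forall i, smooth_at p (f i)) -> smooth_at p (fun q => \sum_(i <- r | P i) f i q).
Proof.
by apply: closed_sum; [exact: smooth_at_cst|exact: smooth_atD].
Qed.

Lemma smooth_at_open p f : smooth_at p f -> \forall q \near p, smooth_at q f.
Proof.
move=> [U [oU Up Uf]]; apply: filterS (open_near oU Up) => q Uq.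
by exists U.
Qed.

Lemma smooth_at_chart c i q : atlas c -> chart_dom c q ->
  smooth_at q (fun q' => c q' 0 i).
Proof.
move=> cA cq; exists (chart_dom c); split=> // [|c' c'A].
  exact: chart_dom_open.
by rewrite setIC; exact: atlas_compatible.
Qed.

End SmoothFunctions.

(** * Coordinate vectors and smooth vector fields *)

Section TangentVectors.
Context {R : realType} {m : nat} {M : manifold R m}.
Implicit Types (p q : M) (f : M -> R) (c : chart R m M) (x y : vec R M).

Lemma vecD x y f : (x + y) f = x f + y f. Proof. by []. Qed.

Lemma vecN x f : (- x) f = - x f. Proof. by []. Qed.

Lemma vecZ (a : R) x f : (a *: x) f = a * x f. Proof. by []. Qed.

Lemma tangent_comb p (a : R) x y : tangent p x -> tangent p y ->
  tangent p (a *: x + y).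
Proof.
move=> [x1 x2 x3 x4] [y1 y2 y3 y4]; split.
- by move=> f nf; rewrite vecD vecZ x1 // y1 // mulr0 addr0.
- by move=> f f' sf sf' ff'; rewrite !(vecD, vecZ) (x2 f f') // (y2 f f').
- move=> b f f' sf sf'; rewrite !(vecD, vecZ) x3 // y3 //; ring.
- move=> f f' sf sf'; rewrite !(vecD, vecZ) x4 // y4 //; ring.
Qed.

Lemma tangent0 p : tangent p (0 : vec R M).
Proof.
split=> //.
- by move=> a f f' _ _ /=; rewrite mulr0 addr0.
- by move=> f f' _ _ /=; rewrite mul0r mulr0 addr0.
Qed.

Lemma tangentD p x y : tangent p x -> tangent p y -> tangent p (x + y).
Proof. by move=> tx ty; rewrite -[x]scale1r; exact: tangent_comb. Qed.

Lemma tangentZ p (a : R) x : tangent p x -> tangent p (a *: x).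
Proof.
by move=> tx; rewrite -[_ *: _]addr0; apply: tangent_comb => //; exact: tangent0.
Qed.

Lemma tangentN p x : tangent p x -> tangent p (- x).
Proof. by move=> tx; rewrite -scaleN1r; exact: tangentZ. Qed.

Lemma tangentB p x y : tangent p x -> tangent p y -> tangent p (x - y).
Proof. by move=> tx ty; apply: tangentD => //; exact: tangentN. Qed.

Lemma tangent_sum p (I : Type) (r : seq I) (P : pred I) (x : I -> vec R M) :
  (forall i, tangent p (x i)) -> tangent p (\sum_(i <- r | P i) x i).
Proof.
move=> tx; elim/big_ind: _ => // [|? ?]; first exact: tangent0.
exact: tangentD.
Qed.

Lemma tangent_cst p x (a : R) : tangent p x -> x (fun=> a) = 0.
Proof.
move=> [_ _ xl xm].
have s1 : smooth_at p (fun=> 1 : R) by exact: smooth_at_cst.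
have x1 : x (fun=> 1) = 0.
  have x11 : x (fun=> 1 * 1) = x (fun=> 1).
    by congr x; apply/funext => ?; rewrite mulr1.
  have /= := xm _ _ s1 s1; rewrite x11 mulr1 mul1r => /eqP.
  by rewrite -subr_eq0 opprD addrA subrr sub0r oppr_eq0 => /eqP.
have xa : x (fun=> (a - 1) * 1 + 1) = x (fun=> a).
  by congr x; apply/funext => ?; rewrite mulr1 subrK.
by have /= := xl (a - 1) _ _ s1 s1; rewrite xa x1 mulr0 addr0.
Qed.

Lemma tangent_near p x f f' : tangent p x -> smooth_at p f ->
  (\forall q \near p, f q = f' q) -> x f = x f'.
Proof. by move=> [_ xn _ _] sf ff'; apply: xn => //; exact: smooth_at_near sf. Qed.

Lemma tangent_add p x f f' : tangent p x -> smooth_at p f -> smooth_at p f' ->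
  x (fun q => f q + f' q) = x f + x f'.
Proof.
move=> [_ _ xl _] sf sf'; rewrite -[X in _ = X + _]mul1r -xl //.
by congr x; apply/funext => q; rewrite mul1r.
Qed.

Lemma tangent_mul p x f f' : tangent p x -> smooth_at p f -> smooth_at p f' ->
  x (fun q => f q * f' q) = x f * f' p + f p * x f'.
Proof. by move=> [_ _ _]; exact. Qed.

Lemma tangent_scale p x f (a : R) : tangent p x -> smooth_at p f ->
  x (fun q => a * f q) = a * x f.
Proof.
move=> tx sf; rewrite (tangent_mul tx) // ?(tangent_cst _ tx) ?mul0r ?add0r //.
exact: smooth_at_cst.
Qed.

Lemma tangent_sumf p x (I : Type) (r : seq I) (f : I -> M -> R) :
  tangent p x -> (forall i, smooth_at p (f i)) ->
  x (fun q => \sum_(i <- r) f i q) = \sum_(i <- r) x (f i).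
Proof.
move=> tx sf; elim: r => [|i r IH].
  rewrite big_nil (_ : (fun _ => _) = fun=> 0) ?(tangent_cst _ tx) //.
  by apply/funext => q; rewrite big_nil.
rewrite big_cons -IH -(tangent_add tx) //; last exact: smooth_at_sum.
by congr x; apply/funext => q; rewrite big_cons.
Qed.

(** The partial derivative along the i-th coordinate of c, as a functional that
    vanishes on the functions that are not smooth at q, as tangent vectors must. *)
Definition coord_vec c q (i : 'I_m) : vec R M := fun f =>
  if `[< smooth_at q f >]
  then 'D_(delta_mx 0 i) (fun z => f (chart_inv c z)) (c q) else 0.

Lemma coord_vecE c q i f : smooth_at q f ->
  coord_vec c q i f = 'D_(delta_mx 0 i) (fun z => f (chart_inv c z)) (c q).
Proof. by move=> sf; rewrite /coord_vec asboolT. Qed.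

Lemma smooth_at_derivable c q i f : atlas c -> chart_dom c q -> smooth_at q f ->
  derivable (fun z => f (chart_inv c z)) (c q) (delta_mx 0 i).
Proof.
move=> cA cq [U [oU Uq Uf]].
have imq : (c @` (U `&` chart_dom c)) (c q) by exists q.
exact: (C_infty_derivable (Uf c cA) imq).
Qed.

Lemma near_chart_inv c q (P : M -> Prop) : chart_dom c q ->
  (\forall q' \near q, P q') -> \forall y \near c q, P (chart_inv c y).
Proof.
move=> cq Pq; apply: (@chart_inv_continuous _ _ _ c (c q)); first by exists q.
by rewrite chart_mapK.
Qed.

Lemma coord_vec_tangent c q i : atlas c -> chart_dom c q ->
  tangent q (coord_vec c q i).
Proof.
move=> cA cq; split.
- by move=> f nf; rewrite /coord_vec asboolF.
- move=> f f' sf sf' ff'; rewrite !coord_vecE //.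
  by apply: near_eq_derive; exact: (near_chart_inv cq ff').
- move=> a f f' sf sf'; rewrite !coord_vecE //; last first.
    by apply: smooth_atD => //; apply: smooth_atM => //; exact: smooth_at_cst.
  have df : derivable (fun z => f (chart_inv c z)) (c q) (delta_mx 0 i).
    exact: smooth_at_derivable.
  have df' : derivable (fun z => f' (chart_inv c z)) (c q) (delta_mx 0 i).
    exact: smooth_at_derivable.
  have daf := derivableM (@derivable_cst _ _ _ a (c q) (delta_mx 0 i)) df.
  rewrite [LHS](deriveD daf df') (deriveM (derivable_cst _ _ _) df) derive_cst.
  by rewrite scaler0 addr0.
- move=> f f' sf sf'; rewrite !coord_vecE //; last exact: smooth_atM.
  have df : derivable (fun z => f (chart_inv c z)) (c q) (delta_mx 0 i).
    exact: smooth_at_derivable.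
  have df' : derivable (fun z => f' (chart_inv c z)) (c q) (delta_mx 0 i).
    exact: smooth_at_derivable.
  rewrite [LHS](deriveM df df') chart_mapK // addrC /GRing.scale /=.
  by congr (_ + _); rewrite mulrC.
Qed.

Lemma coord_vec_coord c q i j : atlas c -> chart_dom c q ->
  coord_vec c q i (fun q' => c q' 0 j) = (i == j)%:R.
Proof.
move=> cA cq; rewrite coord_vecE; last exact: smooth_at_chart.
rewrite -(derive_coord (c q)); apply: near_eq_derive.
have imcq : (c @` chart_dom c) (c q) by exists q.
apply: filterS (open_near (@chart_img_open _ _ _ c) imcq) => y [q' cq' <-].
by rewrite chart_mapK.
Qed.

(** The tangent space at q is spanned by as many vectors as the dimension of
    the manifold. Orthonormal frames provide such vectors, which spares the
    proof that derivations are combinations of partial derivatives. *)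
Definition spanned q := exists2 e : 'I_m -> vec R M, (forall i, tangent q (e i)) &
  forall x, tangent q x -> exists a : 'I_m -> R, x = \sum_i a i *: e i.

(** Expanding the coordinate vectors in a spanning family inverts the matrix of
    values of the family on the coordinate functions. *)
Lemma spanning_family_inverse q c (e : 'I_m -> vec R M) :
  atlas c -> chart_dom c q -> (forall i, tangent q (e i)) ->
  (forall x, tangent q x -> exists a : 'I_m -> R, x = \sum_i a i *: e i) ->
  exists B : 'M[R]_m, B *m (\matrix_(i, j) e i (fun q' => c q' 0 j)) = 1%:M /\
    forall i, coord_vec c q i = \sum_j B i j *: e j.
Proof.
move=> cA cq te spe.
have ex i : exists b : 'I_m -> R, coord_vec c q i = \sum_j b j *: e j.
  by apply: spe; exact: coord_vec_tangent.
have [b bE] := choice ex.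
exists (\matrix_(i, j) b i j); split=> [|i]; last first.
  by rewrite bE; apply: eq_bigr => j _; rewrite mxE.
apply/matrixP => i k; rewrite !mxE -(coord_vec_coord i k cA cq) bE.
rewrite fct_sumE; apply: eq_bigr => j _.
by rewrite !mxE.
Qed.

(** A square matrix with a left inverse is invertible, so that the coordinate
    vectors, being as numerous as a spanning family, span as well. *)
Lemma spanned_coord q c x : spanned q -> atlas c -> chart_dom c q ->
  tangent q x -> x = \sum_i x (fun q' => c q' 0 i) *: coord_vec c q i.
Proof.
move=> [e te spe] cA cq tx.
have [B [BC coordB]] := spanning_family_inverse cA cq te spe.
have CB := mulmx1C BC.
have eE j : e j = \sum_i (e j (fun q' => c q' 0 i)) *: coord_vec c q i.
  transitivity (\sum_k ((1%:M : 'M[R]_m) j k) *: e k).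
    rewrite (bigD1 j) //= big1 ?mxE ?eqxx ?scale1r ?addr0 // => k kj.
    by rewrite mxE eq_sym (negbTE kj) scale0r.
  rewrite -CB; under [RHS]eq_bigr => i _ do rewrite coordB scaler_sumr.
  rewrite exchange_big; apply: eq_bigr => k _; rewrite mxE scaler_suml.
  by apply: eq_bigr => i _; rewrite mxE scalerA.
have [a ->] := spe _ tx.
under [RHS]eq_bigr => i _ do rewrite fct_sumE scaler_suml.
rewrite exchange_big /=; apply: eq_bigr => j _.
rewrite {1}eE scaler_sumr; apply: eq_bigr => i _.
by rewrite scalerA.
Qed.

Lemma near_near p (P : M -> Prop) : (\forall q \near p, P q) ->
  \forall q \near p, \forall q' \near q, P q'.
Proof.
move=> /near_open[V [oV Vp VP]]; apply: filterS (open_near oV Vp) => q Vq.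
by apply: filterS (open_near oV Vq) => q'; exact: VP.
Qed.

(** The partial derivatives of f in another chart are obtained by inverting the
    Jacobian matrix of the change of coordinates, hence are smooth there. *)
Lemma smooth_coord_vec p c i f : (\forall q \near p, spanned q) -> atlas c ->
  chart_dom c p -> smooth_at p f -> smooth_at p (fun q => coord_vec c q i f).
Proof.
move=> sp cA cp sf; have := sf => -[U [oU Up Uf]].
have [V [oV Vp Vs]] := near_open sp.
have oW : open (U `&` V `&` chart_dom c).
  by apply: openI (@chart_dom_open _ _ _ c); exact: openI.
exists (U `&` V `&` chart_dom c); split=> // c' c'A.
set O := c' @` _; have oO : open O by exact: chart_open_image.
have sf' q : U q -> smooth_at q f by exists U.
have Cf : C_infty O (fun z => f (chart_inv c' z)).
  by apply: C_infty_sub (Uf c' c'A) => x [q [[[? ?] ?] ?] <-]; exists q.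
have Cc j : C_infty O (fun z => c (chart_inv c' z) 0 j).
  apply: C_infty_sub (atlas_compatible c'A cA j) => x [q [[[? ?] ?] ?] <-].
  by exists q.
pose J (x : 'rV[R]_m) : 'M[R]_m :=
  \matrix_(j, k) 'D_(delta_mx 0 j) (fun z => c (chart_inv c' z) 0 k) x.
have JE q j k : chart_dom c q -> chart_dom c' q ->
    J (c' q) j k = coord_vec c' q j (fun q' => c q' 0 k).
  by move=> cq c'q; rewrite mxE coord_vecE //; exact: smooth_at_chart.
have Jinv q : V q -> chart_dom c q -> chart_dom c' q ->
    exists B : 'M[R]_m, B *m J (c' q) = 1%:M.
  move=> Vq cq c'q; have spq := Vs _ Vq.
  have [|x tx|B [BJ _]] := @spanning_family_inverse q c (coord_vec c' q) cA cq.
  - by move=> j; exact: coord_vec_tangent.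
  - by exists (fun j => x (fun q' => c' q' 0 j)); exact: spanned_coord.
  exists B; rewrite -BJ; congr (_ *m _); apply/matrixP => j k.
  by rewrite JE // [RHS]mxE.
have Junit q : V q -> chart_dom c q -> chart_dom c' q -> J (c' q) \in unitmx.
  by move=> Vq cq c'q; have [B /mulmx1_unit[]] := Jinv q Vq cq c'q.
have CJ j k : C_infty O (fun z => J z j k).
  apply: (C_infty_ext (f := 'D_(delta_mx 0 j) (fun z => c (chart_inv c' z) 0 k)) oO).
    by move=> x _; rewrite mxE.
  exact: C_infty_derive.
have Ccst (a : R) : C_infty O (fun=> a) by move=> r; exact: C_order_cst.
have CdetV : C_infty O (fun z => (\det (J z))^-1).
  apply: C_inftyV => //.
    move=> x [q [[[Uq Vq] cq] c'q] <-].
    by have := Junit q Vq cq c'q; rewrite unitmxE unitfE.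
  by apply: closed_det => // *; [exact: C_inftyD|exact: C_inftyM].
have CinvJ := closed_inv_mx Ccst (fun _ _ => @C_inftyD _ _ O _ _ oO)
  (fun _ _ => @C_inftyM _ _ O _ _ oO) CJ CdetV.
have Csum : C_infty O (fun z => \sum_j ((\det (J z))^-1 *: \adj (J z)) i j
    * 'D_(delta_mx 0 j) (fun z => f (chart_inv c' z)) z).
  apply: closed_sum => //.
    by move=> *; exact: C_inftyD.
  by move=> j; apply: C_inftyM => //; exact: C_infty_derive.
apply: C_infty_ext Csum => // x [q [[[Uq Vq] cq] c'q] <-]; rewrite chart_mapK //.
have Ju := Junit q Vq cq c'q.
have invE : (\det (J (c' q)))^-1 *: \adj (J (c' q)) = invmx (J (c' q)).
  by rewrite /invmx Ju.
rewrite invE.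
(* Expand the partial derivatives of f in c' along those in c and cancel J. *)
under eq_bigr => j _.
  rewrite -[X in _ * X](coord_vecE c' j (sf' _ Uq)).
  rewrite (spanned_coord (Vs _ Vq) cA cq (coord_vec_tangent j c'A c'q)) fct_sumE.
  under eq_bigr => k _ do rewrite -JE //.
  over.
transitivity (\sum_k (invmx (J (c' q)) *m J (c' q)) i k * coord_vec c q k f).
  under [RHS]eq_bigr => k _ do rewrite mxE mulr_suml.
  rewrite [RHS]exchange_big; apply: eq_bigr => j _; rewrite mulr_sumr.
  by apply: eq_bigr => k _; rewrite /= mulrA.
rewrite mulVmx // (bigD1 i) //= big1 ?mxE ?eqxx ?mul1r ?addr0 // => k ki.
by rewrite mxE eq_sym (negbTE ki) mul0r.
Qed.

Lemma smooth_fieldP p X f : smooth_field_at p X -> smooth_at p f ->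
  smooth_at p (fun q => X q f).
Proof. by move=> [_]; exact. Qed.

Lemma smooth_field_tangent p X : smooth_field_at p X -> tangent p (X p).
Proof. by move=> [tX _]; exact: nbhs_singleton tX. Qed.

Lemma chart_dom_near p c : chart_dom c p -> \forall q \near p, chart_dom c q.
Proof. by move=> cp; exact: (open_near (@chart_dom_open _ _ _ c) cp). Qed.

(** In coordinates a smooth field is the combination of coordinate fields with
    smooth coefficients, on a neighbourhood that serves all test functions. *)
Lemma smooth_field_open p X : (\forall q \near p, spanned q) ->
  smooth_field_at p X -> \forall q \near p, smooth_field_at q X.
Proof.
move=> sp sX; have [c cA cp] := atlas_cover p.
have sXc : \forall q \near p, forall i, smooth_at q (fun q' => X q' (fun r => c r 0 i)).
  apply: near_forall_fin => i; apply: smooth_at_open; apply: smooth_fieldP => //.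
  exact: smooth_at_chart.
have /near_near nX := sX.1; have /near_near nsp := sp.
have /near_near nc := chart_dom_near cp.
near=> q.
have spq : \forall q' \near q, spanned q' by near: q.
have tXq : \forall q' \near q, tangent q' (X q') by near: q.
have cq : \forall q' \near q, chart_dom c q' by near: q.
have sXcq : forall i, smooth_at q (fun q' => X q' (fun r => c r 0 i)) by near: q.
split=> // f sf.
apply: (@smooth_at_near _ _ _ _ (fun q' => \sum_i X q' (fun r => c r 0 i) *
  coord_vec c q' i f)); last first.
  apply: smooth_at_sum => i; apply: smooth_atM => //.
  by apply: smooth_coord_vec => //; exact: nbhs_singleton cq.
near=> q'.
have tXq' : tangent q' (X q') by near: q'.
have spq' : spanned q' by near: q'.
have cq' : chart_dom c q' by near: q'.
by rewrite {2}(spanned_coord spq' cA cq' tXq') fct_sumE.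
Unshelve. all: by end_near. Qed.

(** Evaluating on coordinate functions turns the components of a field in a
    frame into the solution of an invertible linear system with smooth
    coefficients. *)
Lemma smooth_components p (G : 'I_m -> vfield R M) X (x : M -> 'I_m -> R) :
  (forall i, smooth_field_at p (G i)) -> smooth_field_at p X ->
  (\forall q \near p, forall y, tangent q y ->
     exists a : 'I_m -> R, y = \sum_i a i *: G i q) ->
  (\forall q \near p, X q = \sum_i x q i *: G i q) ->
  forall i, smooth_at p (fun q => x q i).
Proof.
move=> sG sX nG nx i; have [c cA cp] := atlas_cover p.
have sc j : smooth_at p (fun q => c q 0 j) by exact: smooth_at_chart.
pose A q : 'M[R]_m := \matrix_(i, j) G i q (fun q' => c q' 0 j).
have Au : \forall q \near p, A q \in unitmx.
  near=> q.
  have cq : chart_dom c q by near: q; exact: chart_dom_near.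
  have tG : forall i, tangent q (G i q).
    by near: q; apply: near_forall_fin => j; exact: (sG j).1.
  have spG : forall y, tangent q y -> exists a : 'I_m -> R, y = \sum_i a i *: G i q.
    by near: q.
  have [B [BA _]] := spanning_family_inverse cA cq tG spG.
  by have [] := mulmx1_unit BA.
have sA j k : smooth_at p (fun q => A q j k).
  rewrite (_ : (fun _ => _) = fun q => G j q (fun q' => c q' 0 k)).
    exact: smooth_fieldP.
  by apply/funext => q; rewrite mxE.
have sdetV : smooth_at p (fun q => (\det (A q))^-1).
  apply: smooth_atV.
    by apply: filterS Au => q; rewrite unitmxE unitfE.
  by apply: closed_det => // *; [exact: smooth_at_cst|exact: smooth_atD|exact: smooth_atM].
have sinv := closed_inv_mx (@smooth_at_cst _ _ _ p) (@smooth_atD _ _ _ p)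
  (@smooth_atM _ _ _ p) sA sdetV.
apply: (@smooth_at_near _ _ _ _ (fun q => \sum_j X q (fun r => c r 0 j) *
   ((\det (A q))^-1 *: \adj (A q)) j i)); last first.
  by apply: smooth_at_sum => j; apply: smooth_atM => //; exact: smooth_fieldP.
near=> q.
have Aq : A q \in unitmx by near: q.
have Xq : X q = \sum_i x q i *: G i q by near: q.
have invE : (\det (A q))^-1 *: \adj (A q) = invmx (A q) by rewrite /invmx Aq.
rewrite invE.
transitivity (\sum_k x q k * (A q *m invmx (A q)) k i).
  under [RHS]eq_bigr => k _ do rewrite mxE mulr_sumr.
  rewrite [RHS]exchange_big; apply: eq_bigr => j _ /=.
  rewrite Xq fct_sumE mulr_suml; apply: eq_bigr => k _.
  by rewrite mxE mulrA.
rewrite mulmxV // (bigD1 i) //= big1 ?mxE ?eqxx ?mulr1 ?addr0 // => k ki.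
by rewrite mxE (negbTE ki) mulr0.
Unshelve. all: by end_near. Qed.

End TangentVectors.

(** Linear identities between tangent vectors are checked on test functions. *)
Ltac vec_ring := apply/funext => ?; rewrite ?(vecD, vecN, vecZ); ring.

Section SmoothFields.
Context {R : realType} {m : nat} {M : manifold R m}.
Implicit Types (p q : M) (f : M -> R) (X Y : vfield R M).

Lemma smooth_field_near p X Y : (\forall q \near p, X q = Y q) ->
  smooth_field_at p X -> smooth_field_at p Y.
Proof.
move=> XY [tX sX]; split; first by apply: filterS2 XY tX => q ->.
move=> f sf; apply: smooth_at_near (sX f sf).
by apply: filterS XY => q ->.
Qed.

Lemma smooth_fieldD p X Y : smooth_field_at p X -> smooth_field_at p Y ->
  smooth_field_at p (fun q => X q + Y q).
Proof.
move=> [tX sX] [tY sY]; split; first by apply: filterS2 tX tY => q; exact: tangentD.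
by move=> f sf; apply: smooth_atD; [exact: sX|exact: sY].
Qed.

Lemma smooth_fieldZ p f X : smooth_at p f -> smooth_field_at p X ->
  smooth_field_at p (fun q => f q *: X q).
Proof.
move=> sf [tX sX]; split; first by apply: filterS tX => q; exact: tangentZ.
by move=> f' sf'; apply: smooth_atM => //; exact: sX.
Qed.

Lemma smooth_field0 p : smooth_field_at p (fun=> 0 : vec R M).
Proof.
split; first by near=> q; exact: tangent0.
by move=> f _; exact: smooth_at_cst.
Unshelve. all: by end_near. Qed.

Lemma smooth_field_sum p (I : Type) (r : seq I) (X : I -> vfield R M) :
  (forall i, smooth_field_at p (X i)) ->
  smooth_field_at p (fun q => \sum_(i <- r) X i q).
Proof.
move=> sX; elim: r => [|i r IH].
  apply: smooth_field_near (smooth_field0 p).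
  by near=> q; rewrite big_nil.
apply: smooth_field_near (smooth_fieldD (sX i) IH).
by near=> q; rewrite big_cons.
Unshelve. all: by end_near. Qed.

End SmoothFields.

(** * Metrics and orthonormal bases *)

(** The algebraic part of the axioms of a metric, which an induced metric
    inherits without any smoothness argument. *)
Definition sym_bilinear {R : realType} {m : nat} {M : manifold R m}
    (g : M -> vec R M -> vec R M -> R) : Prop :=
  (forall p x y, tangent p x -> tangent p y -> g p x y = g p y x) /\
  (forall p (a : R) x y z, tangent p x -> tangent p y -> tangent p z ->
    g p (a *: x + y) z = a * g p x z + g p y z).

Section Metrics.
Context {R : realType} {m : nat} {M : manifold R m}.
Variable g : M -> vec R M -> vec R M -> R.
Hypothesis hg : sym_bilinear g.
Let g_sym := hg.1.
Let g_lin := hg.2.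
Implicit Types (p q : M).

Lemma metric0l p y : tangent p y -> g p 0 y = 0.
Proof.
move=> ty; have t0 := tangent0 p.
have := g_lin (-1) t0 t0 ty; rewrite scaler0 addr0 mulN1r.
by rewrite addNr.
Qed.

Lemma metricDl p x y z : tangent p x -> tangent p y -> tangent p z ->
  g p (x + y) z = g p x z + g p y z.
Proof. by move=> *; rewrite -{1}[x]scale1r g_lin // mul1r. Qed.

Lemma metricZl p a x z : tangent p x -> tangent p z -> g p (a *: x) z = a * g p x z.
Proof.
move=> tx tz; rewrite -[a *: x]addr0 g_lin // ?metric0l ?addr0 //.
exact: tangent0.
Qed.

Lemma metricNl p x z : tangent p x -> tangent p z -> g p (- x) z = - g p x z.
Proof. by move=> *; rewrite -scaleN1r metricZl // mulN1r. Qed.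

Lemma metricBl p x y z : tangent p x -> tangent p y -> tangent p z ->
  g p (x - y) z = g p x z - g p y z.
Proof.
by move=> tx ty tz; rewrite metricDl ?metricNl //; exact: tangentN.
Qed.

Lemma metric_suml p (I : Type) (r : seq I) (x : I -> vec R M) z :
  (forall i, tangent p (x i)) -> tangent p z ->
  g p (\sum_(i <- r) x i) z = \sum_(i <- r) g p (x i) z.
Proof.
move=> tx tz; elim: r => [|i r IH]; first by rewrite !big_nil metric0l.
by rewrite !big_cons metricDl ?IH //; exact: tangent_sum.
Qed.

Lemma metricDr p x y z : tangent p x -> tangent p y -> tangent p z ->
  g p z (x + y) = g p z x + g p z y.
Proof.
move=> tx ty tz; have tD := tangentD tx ty.
by rewrite g_sym // metricDl // !(g_sym tz).
Qed.

Lemma metricZr p a x z : tangent p x -> tangent p z -> g p z (a *: x) = a * g p z x.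
Proof.
by move=> tx tz; rewrite g_sym ?metricZl ?(g_sym tz) //; exact: tangentZ.
Qed.

Lemma metricNr p x z : tangent p x -> tangent p z -> g p z (- x) = - g p z x.
Proof. by move=> *; rewrite -scaleN1r metricZr // mulN1r. Qed.

Lemma metricBr p x y z : tangent p x -> tangent p y -> tangent p z ->
  g p z (x - y) = g p z x - g p z y.
Proof.
by move=> tx ty tz; rewrite metricDr ?metricNr //; exact: tangentN.
Qed.

Lemma metric_sumr p (I : Type) (r : seq I) (x : I -> vec R M) z :
  (forall i, tangent p (x i)) -> tangent p z ->
  g p z (\sum_(i <- r) x i) = \sum_(i <- r) g p z (x i).
Proof.
move=> tx tz; rewrite g_sym //; last exact: tangent_sum.
by rewrite metric_suml //; apply: eq_bigr => i _; rewrite g_sym.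
Qed.

Lemma on_basis_coord r q (e : 'I_r -> vec R M) (a : 'I_r -> R) j :
  on_basis g q e -> g q (\sum_i a i *: e i) (e j) = a j.
Proof.
move=> [te ge _]; rewrite metric_suml // => [|i]; last exact: tangentZ.
rewrite (bigD1 j) //= big1 ?addr0 => [|i ij]; rewrite metricZl // ge.
  by rewrite eqxx mulr1.
by rewrite (negbTE ij) mulr0.
Qed.

Lemma on_basis_expand r q (e : 'I_r -> vec R M) x :
  on_basis g q e -> tangent q x -> x = \sum_i g q x (e i) *: e i.
Proof.
move=> be tx; have [_ _ spe] := be; have [a xE] := spe _ tx.
by rewrite {1}xE; apply: eq_bigr => i _; rewrite xE on_basis_coord.
Qed.

Lemma on_basis_ext r q (e : 'I_r -> vec R M) x y :
  on_basis g q e -> tangent q x -> tangent q y ->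
  (forall i, g q x (e i) = g q y (e i)) -> x = y.
Proof.
move=> be tx ty xy; rewrite (on_basis_expand be tx) (on_basis_expand be ty).
by apply: eq_bigr => i _; rewrite xy.
Qed.

(** Two orthonormal bases differ by an orthogonal matrix, so that traces do not
    depend on the basis. The trace over e is written through the expansion of e
    in e', since the tensors below are linear only once their arguments are
    expanded in smooth fields. *)
Lemma on_basis_trace (V : lmodType R) r r' q (e : 'I_r -> vec R M)
    (e' : 'I_r' -> vec R M) (B : 'I_r' -> 'I_r' -> V) :
  on_basis g q e -> on_basis g q e' ->
  \sum_a \sum_b g q (e a) (e' b) *: \sum_c g q (e a) (e' c) *: B c b =
  \sum_b B b b.
Proof.
move=> be be'; have [te _ _] := be; have [te' ge' _] := be'.
rewrite exchange_big; apply: eq_bigr => b _ /=.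
under eq_bigr => a _ do rewrite scaler_sumr.
rewrite exchange_big /=; transitivity (\sum_c (c == b)%:R *: B c b).
  apply: eq_bigr => c _; rewrite -ge' [in RHS](on_basis_expand be (te' c)).
  rewrite metric_suml // => [|a]; last exact: tangentZ.
  rewrite scaler_suml; apply: eq_bigr => a _.
  by rewrite scalerA metricZl // [g q (e' c) _]g_sym // mulrC.
rewrite (bigD1 b) //= big1 ?eqxx ?scale1r ?addr0 // => c cb.
by rewrite (negbTE cb) scale0r.
Qed.

Lemma on_frame_spanned p (G : 'I_m -> vfield R M) : on_frame g p G ->
  \forall q \near p, spanned q.
Proof. by move=> [_ nG]; apply: filterS nG => q [tG _ spG]; exists (G ^~ q). Qed.

Lemma on_frame_coord_smooth p (G : 'I_m -> vfield R M) X : on_frame g p G ->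
  smooth_field_at p X -> forall i, smooth_at p (fun q => g q (X q) (G i q)).
Proof.
move=> [sG nG] sX; apply: (smooth_components sG sX).
  by apply: filterS nG => q [].
by apply: filterS2 nG sX.1 => q; exact: on_basis_expand.
Qed.

(** Nondegeneracy identifies the dual vector that the definition of sharp only
    selects. *)
Lemma sharpE r p (e : 'I_r -> vfield R M) (om : vfield R M -> R) w :
  (forall i, smooth_field_at p (e i)) -> on_basis g p (e ^~ p) ->
  tangent p w -> (forall Y, smooth_field_at p Y -> g p w (Y p) = om Y) ->
  sharp g p om = w.
Proof.
move=> se be tw wom; rewrite /sharp; case: xgetP => [w' _ [tw' w'om]|/(_ w) []//].
by apply: (on_basis_ext be) => // i; rewrite (w'om (e i)) // (wom (e i)).
Qed.

End Metrics.

(** * Connections *)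

Section Connections.
Context {R : realType} {m : nat} {M : manifold R m}.
Variable D : M -> vec R M -> vfield R M -> vec R M.
Hypothesis hD : connection D.
Implicit Types (p q : M) (f : M -> R) (x y : vec R M) (X Y Z : vfield R M).

Lemma conn_tangent p x Y : tangent p x -> smooth_field_at p Y -> tangent p (D p x Y).
Proof. by case: hD => + _ _ _ _; exact. Qed.

Lemma conn_near p x Y Z : tangent p x -> smooth_field_at p Y ->
  (\forall q \near p, Y q = Z q) -> D p x Y = D p x Z.
Proof.
case: hD => _ h _ _ _ tx sY YZ; apply: h => //.
exact: smooth_field_near sY.
Qed.

Lemma cov_smooth p X Y : smooth_field_at p X -> smooth_field_at p Y ->
  smooth_field_at p (cov D X Y).
Proof. by case: hD => _ _ + _ _; exact. Qed.

Lemma cov_tangent p X Y : smooth_field_at p X -> smooth_field_at p Y ->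
  tangent p (cov D X Y p).
Proof. by move=> sX sY; apply: conn_tangent => //; exact: smooth_field_tangent. Qed.

Lemma conn_lin p a x y Y : tangent p x -> tangent p y -> smooth_field_at p Y ->
  D p (a *: x + y) Y = a *: D p x Y + D p y Y.
Proof. by case: hD => _ _ _ + _; exact. Qed.

Lemma connDl p x y Y : tangent p x -> tangent p y -> smooth_field_at p Y ->
  D p (x + y) Y = D p x Y + D p y Y.
Proof. by move=> *; rewrite -{1}[x]scale1r conn_lin // scale1r. Qed.

Lemma conn0l p Y : smooth_field_at p Y -> D p 0 Y = 0.
Proof.
move=> sY; have t0 := @tangent0 _ _ _ p.
have := conn_lin (-1) t0 t0 sY; rewrite scaler0 addr0 scaleN1r.
by rewrite addNr.
Qed.

Lemma connZl p a x Y : tangent p x -> smooth_field_at p Y ->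
  D p (a *: x) Y = a *: D p x Y.
Proof.
move=> tx sY; rewrite -[a *: x]addr0 conn_lin // ?conn0l ?addr0 //.
exact: tangent0.
Qed.

Lemma connBl p x y Y : tangent p x -> tangent p y -> smooth_field_at p Y ->
  D p (x - y) Y = D p x Y - D p y Y.
Proof.
move=> tx ty sY; rewrite -scaleN1r connDl // ?connZl ?scaleN1r //.
exact: tangentN.
Qed.

Lemma conn_suml p (I : Type) (r : seq I) (x : I -> vec R M) Y :
  (forall i, tangent p (x i)) -> smooth_field_at p Y ->
  D p (\sum_(i <- r) x i) Y = \sum_(i <- r) D p (x i) Y.
Proof.
move=> tx sY; elim: r => [|i r IH]; first by rewrite !big_nil conn0l.
by rewrite !big_cons connDl ?IH //; exact: tangent_sum.
Qed.

Lemma connDr p x Y Z : tangent p x -> smooth_field_at p Y -> smooth_field_at p Z ->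
  D p x (fun q => Y q + Z q) = D p x Y + D p x Z.
Proof. by case: hD => _ _ _ _ [+ _]; exact. Qed.

Lemma conn_leibniz p x f Y : tangent p x -> smooth_at p f -> smooth_field_at p Y ->
  D p x (fun q => f q *: Y q) = x f *: Y p + f p *: D p x Y.
Proof. by case: hD => _ _ _ _ [_]; exact. Qed.

Lemma connZr p x (a : R) Y : tangent p x -> smooth_field_at p Y ->
  D p x (fun q => a *: Y q) = a *: D p x Y.
Proof.
move=> tx sY; have sa := @smooth_at_cst _ _ _ p a.
by rewrite (conn_leibniz tx sa sY) (tangent_cst _ tx) scale0r add0r.
Qed.

Lemma conn0r p x : tangent p x -> D p x (fun=> 0) = 0.
Proof.
move=> tx; have s0 := @smooth_field0 _ _ _ p.
rewrite -[RHS](scale0r (D p x (fun=> 0))) -connZr //.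
by congr (D p x); apply/funext => q; rewrite scaler0.
Qed.

Lemma conn_sumr p x (I : Type) (r : seq I) (Y : I -> vfield R M) :
  tangent p x -> (forall i, smooth_field_at p (Y i)) ->
  D p x (fun q => \sum_(i <- r) Y i q) = \sum_(i <- r) D p x (Y i).
Proof.
move=> tx sY; elim: r => [|i r IH].
  transitivity (D p x (fun=> 0)); last by rewrite big_nil conn0r.
  congr (D p x); apply/funext => q; exact: big_nil.
rewrite big_cons -IH -connDr //; last exact: smooth_field_sum.
by congr (D p x); apply/funext => q; rewrite big_cons.
Qed.

Lemma conn_combr p x (I : finType) (a : I -> M -> R) (G : I -> vfield R M) :
  tangent p x -> (forall b, smooth_at p (a b)) -> (forall b, smooth_field_at p (G b)) ->
  D p x (fun q => \sum_b a b q *: G b q) =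
  \sum_b (x (a b) *: G b p + a b p *: D p x (G b)).
Proof.
move=> tx sa sG; rewrite conn_sumr // => [|b]; last exact: smooth_fieldZ.
by apply: eq_bigr => b _; rewrite conn_leibniz.
Qed.

(** The second covariant derivative of Z; it depends on Y only through its value
    at p, although the two terms separately do not. *)
Definition hess p x Y Z : vec R M := D p x (cov D Y Z) - D p (D p x Y) Z.

Lemma hess_suml p (I : finType) (a : I -> R) (x : I -> vec R M) Y Z :
  (forall b, tangent p (x b)) -> smooth_field_at p Y -> smooth_field_at p Z ->
  hess p (\sum_b a b *: x b) Y Z = \sum_b a b *: hess p (x b) Y Z.
Proof.
move=> tx sY sZ; rewrite /hess.
have tax b : tangent p (a b *: x b) by exact: tangentZ.
have sYZ := cov_smooth sY sZ.
rewrite !conn_suml // => [|b]; last exact: conn_tangent.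
rewrite -sumrB; apply: eq_bigr => b _.
rewrite !connZl // ?scalerBr //; exact: conn_tangent.
Qed.

Lemma hess_sumr p (I : finType) x (a : I -> M -> R) (G : I -> vfield R M) Y Z :
  tangent p x -> (forall b, smooth_at p (a b)) ->
  (forall b, smooth_field_at p (G b)) -> smooth_field_at p Z ->
  (\forall q \near p, spanned q) -> (\forall q \near p, Y q = \sum_b a b q *: G b q) ->
  hess p x Y Z = \sum_b a b p *: hess p x (G b) Z.
Proof.
move=> tx sa sG sZ sp YE; rewrite /hess.
have saG b : smooth_field_at p (fun q => a b q *: G b q) by exact: smooth_fieldZ.
have sY : smooth_field_at p Y.
  apply: smooth_field_near (smooth_field_sum (index_enum I) saG).
  by apply: filterS YE => q ->.
have tG : \forall q \near p, forall b, tangent q (G b q).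
  by apply: near_forall_fin => b; exact: (sG b).1.
have covE : \forall q \near p, cov D Y Z q = \sum_b a b q *: cov D (G b) Z q.
  near=> q.
  have tGq : forall b, tangent q (G b q) by near: q.
  have YEq : Y q = \sum_b a b q *: G b q by near: q.
  have sZq : smooth_field_at q Z by near: q; exact: smooth_field_open.
  have taGq b : tangent q (a b q *: G b q) by exact: tangentZ.
  rewrite /cov YEq conn_suml //; apply: eq_bigr => b _; exact: connZl.
have sGZ b : smooth_field_at p (cov D (G b) Z) by exact: cov_smooth.
have tp b : tangent p (G b p) by exact: smooth_field_tangent.
have tDG b : tangent p (D p x (G b)) by exact: conn_tangent.
rewrite (conn_near tx (cov_smooth sY sZ) covE) (conn_near tx sY YE).
rewrite !conn_combr // conn_suml // => [|b]; last first.
  by apply: tangentD; exact: tangentZ.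
rewrite -sumrB; apply: eq_bigr => b _.
rewrite connDl ?connZl //; try exact: tangentZ.
by rewrite /cov scalerBr opprD addrACA subrr add0r.
Unshelve. all: by end_near. Qed.

(** The Bochner Laplacian is minus a trace of the second covariant derivative,
    hence does not depend on the orthonormal frame. *)
Lemma bochner_laplacian_frame (g : M -> vec R M -> vec R M -> R) p
    (F G : 'I_m -> vfield R M) Z :
  sym_bilinear g -> on_frame g p F -> on_frame g p G -> smooth_field_at p Z ->
  bochner_laplacian D F Z p = bochner_laplacian D G Z p.
Proof.
move=> hg fF fG sZ; have [sF nF] := fF; have [sG nG] := fG.
have bF := nbhs_singleton nF; have bG := nbhs_singleton nG.
rewrite /bochner_laplacian; congr (- _).
rewrite -[RHS](on_basis_trace (q := p) (e := F ^~ p) (e' := G ^~ p) hg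
  (fun c b => hess p (G c p) (G b) Z)) //.
have tF a : tangent p (F a p) by exact: smooth_field_tangent.
have tG a : tangent p (G a p) by exact: smooth_field_tangent.
apply: eq_bigr => a _; rewrite -[LHS]/(hess p (F a p) (F a) Z).
rewrite (@hess_sumr p _ _ (fun b q => g q (F a q) (G b q)) G (F a)) //.
- apply: eq_bigr => b _; congr (_ *: _).
  rewrite -hess_suml //; congr (hess _ _ _ _); exact: on_basis_expand.
- by move=> b; exact: (on_frame_coord_smooth hg fG (sF a)).
- exact: on_frame_spanned fG.
- by apply: filterS2 nG (sF a).1 => q; exact: on_basis_expand.
Qed.

End Connections.

(** * The curvature of the Levi-Civita connection *)

Section LeviCivita.
Context {R : realType} {m : nat} {M : manifold R m}.
Variable g : M -> vec R M -> vec R M -> R.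
Variable D : M -> vec R M -> vfield R M -> vec R M.
Hypothesis hg : sym_bilinear g.
Let g_sym := hg.1.
Let g_lin := hg.2.
Hypothesis hD : levi_civita g D.
Implicit Types (p q : M) (f : M -> R) (x y : vec R M) (X Y Z W : vfield R M).

Lemma levi_civita_connection : connection D. Proof. by case: hD. Qed.
Let cD := levi_civita_connection.

Lemma levi_civita_torsion p X Y : smooth_field_at p X -> smooth_field_at p Y ->
  lie_bracket X Y p = cov D X Y p - cov D Y X p.
Proof. by case: hD => _ + _ => h sX sY; rewrite h. Qed.

Lemma levi_civita_metric p x Y Z : tangent p x -> smooth_field_at p Y ->
  smooth_field_at p Z ->
  x (fun q => g q (Y q) (Z q)) = g p (D p x Y) (Z p) + g p (Y p) (D p x Z).
Proof. by case: hD => _ _; exact. Qed.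

Lemma lie_bracket_tangent p X Y : smooth_field_at p X -> smooth_field_at p Y ->
  tangent p (lie_bracket X Y p).
Proof.
by move=> sX sY; rewrite levi_civita_torsion //; apply: tangentB; exact: cov_tangent.
Qed.

(** The curvature antisymmetrizes the second covariant derivative, from which it
    inherits tensoriality in X and Y. *)
Lemma curvature_hess p X Y Z : smooth_field_at p X -> smooth_field_at p Y ->
  smooth_field_at p Z ->
  curvature D X Y Z p = hess D p (X p) Y Z - hess D p (Y p) X Z.
Proof.
move=> sX sY sZ; rewrite /curvature /hess /cov levi_civita_torsion //.
have tXY := cov_tangent cD sX sY; have tYX := cov_tangent cD sY sX.
by rewrite (connBl cD) //; rewrite /cov; vec_ring.
Qed.

Lemma curvature_tangent p X Y Z : smooth_field_at p X -> smooth_field_at p Y ->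
  smooth_field_at p Z -> tangent p (curvature D X Y Z p).
Proof.
move=> sX sY sZ; rewrite /curvature; apply: tangentB; first apply: tangentB.
- exact: (cov_tangent cD sX (cov_smooth cD sY sZ)).
- exact: (cov_tangent cD sY (cov_smooth cD sX sZ)).
- exact: (conn_tangent cD (lie_bracket_tangent sX sY) sZ).
Qed.

Lemma curvature_sum p (I : finType) (a : I -> M -> R) (G : I -> vfield R M) X Y Z :
  (forall b, smooth_at p (a b)) -> (forall b, smooth_field_at p (G b)) ->
  smooth_field_at p Y -> smooth_field_at p Z -> (\forall q \near p, spanned q) ->
  (\forall q \near p, X q = \sum_b a b q *: G b q) ->
  curvature D X Y Z p = \sum_b a b p *: curvature D (G b) Y Z p.
Proof.
move=> sa sG sY sZ sp XE.
have saG b : smooth_field_at p (fun q => a b q *: G b q) by exact: smooth_fieldZ.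
have sX : smooth_field_at p X.
  apply: smooth_field_near (smooth_field_sum (index_enum I) saG).
  by apply: filterS XE => q ->.
have tY := smooth_field_tangent sY.
have tG b : tangent p (G b p) by exact: smooth_field_tangent.
rewrite curvature_hess // (hess_sumr cD tY sa sG sZ sp XE).
rewrite (nbhs_singleton XE) hess_suml // -sumrB.
by apply: eq_bigr => b _; rewrite curvature_hess // [RHS]scalerBr.
Qed.

Hypothesis g_smooth : forall p X Y, smooth_field_at p X -> smooth_field_at p Y ->
  smooth_at p (fun q => g q (X q) (Y q)).

(** Metric compatibility makes the curvature operator skew-adjoint: apply the
    Lie bracket of X and Y to the function g(Z, W). *)
Lemma curvature_skew p X Y Z W : (\forall q \near p, spanned q) ->
  smooth_field_at p X -> smooth_field_at p Y ->
  smooth_field_at p Z -> smooth_field_at p W ->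
  g p (curvature D X Y Z p) (W p) = - g p (Z p) (curvature D X Y W p).
Proof.
move=> sp sX sY sZ sW; pose f q := g q (Z q) (W q).
have sf : smooth_at p f by exact: g_smooth.
have second U V : smooth_field_at p U -> smooth_field_at p V ->
  U p (fun q => V q f) = g p (cov D U (cov D V Z) p) (W p)
    + g p (cov D V Z p) (cov D U W p)
    + (g p (cov D U Z p) (cov D V W p) + g p (Z p) (cov D U (cov D V W) p)).
  move=> sU sV; have tU := smooth_field_tangent sU.
  have sVZ := cov_smooth cD sV sZ; have sVW := cov_smooth cD sV sW.
  rewrite -!(levi_civita_metric tU) //.
  rewrite -(tangent_add tU); [|exact: g_smooth|exact: g_smooth].
  apply: (tangent_near tU); first exact: smooth_fieldP.
  near=> q; have tVq : tangent q (V q) by near: q; exact: sV.1.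
  have sZq : smooth_field_at q Z by near: q; exact: smooth_field_open.
  have sWq : smooth_field_at q W by near: q; exact: smooth_field_open.
  by rewrite (levi_civita_metric tVq).
have tB := lie_bracket_tangent sX sY.
have := levi_civita_metric tB sZ sW.
rewrite {1}/lie_bracket asboolT // (second _ _ sX sY) (second _ _ sY sX).
rewrite /curvature.
have sXZ := cov_smooth cD sX sZ; have sYZ := cov_smooth cD sY sZ.
have sXW := cov_smooth cD sX sW; have sYW := cov_smooth cD sY sW.
have tW := smooth_field_tangent sW; have tZ := smooth_field_tangent sZ.
have tZ1 := cov_tangent cD sX sYZ; have tZ2 := cov_tangent cD sY sXZ.
have tZ3 := conn_tangent cD tB sZ.
have tW1 := cov_tangent cD sX sYW; have tW2 := cov_tangent cD sY sXW.
have tW3 := conn_tangent cD tB sW.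
have tZ12 := tangentB tZ1 tZ2; have tW12 := tangentB tW1 tW2.
have -> : g p (cov D X (cov D Y Z) p - cov D Y (cov D X Z) p
    - cov D (lie_bracket X Y) Z p) (W p) =
    g p (cov D X (cov D Y Z) p) (W p) - g p (cov D Y (cov D X Z) p) (W p)
    - g p (D p (lie_bracket X Y p) Z) (W p).
  by rewrite (metricBl hg tZ12 tZ3 tW) (metricBl hg tZ1 tZ2 tW).
have -> : g p (Z p) (cov D X (cov D Y W) p - cov D Y (cov D X W) p
    - cov D (lie_bracket X Y) W p) =
    g p (Z p) (cov D X (cov D Y W) p) - g p (Z p) (cov D Y (cov D X W) p)
    - g p (Z p) (D p (lie_bracket X Y p) W).
  by rewrite (metricBr hg tW12 tW3 tZ) (metricBr hg tW1 tW2 tZ).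
move=> e; apply/eqP; rewrite -subr_eq0; apply/eqP; rewrite -[RHS](subrr
  (g p (D p (lie_bracket X Y p) Z) (W p) + g p (Z p) (D p (lie_bracket X Y p) W))).
rewrite -{1}e; ring.
Unshelve. all: by end_near. Qed.

(** The Ricci form is a trace of a bilinear form, hence does not depend on the
    orthonormal frame. *)
Lemma ricci_frame p (F G : 'I_m -> vfield R M) X Y : on_frame g p F ->
  on_frame g p G -> smooth_field_at p X -> smooth_field_at p Y ->
  ricci g D F X Y p = ricci g D G X Y p.
Proof.
move=> fF fG sX sY; have [sF nF] := fF; have [sG nG] := fG.
have bF := nbhs_singleton nF; have bG := nbhs_singleton nG.
have tG b : tangent p (G b p) by exact: smooth_field_tangent.
have tF b : tangent p (F b p) by exact: smooth_field_tangent.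
have tC b : tangent p (curvature D (G b) X Y p) by exact: curvature_tangent.
rewrite /ricci -[RHS](@on_basis_trace _ _ _ _ hg R^o _ _ p (F ^~ p) (G ^~ p)
  (fun c b => g p (curvature D (G b) X Y p) (G c p))) //.
apply: eq_bigr => a _.
rewrite (@curvature_sum p _ (fun b q => g q (F a q) (G b q)) G (F a) X Y) //.
- rewrite (metric_suml hg) // => [|b]; last exact: tangentZ.
  apply: eq_bigr => b _; rewrite (metricZl hg) //; congr (_ * _).
  rewrite {1}(on_basis_expand hg bG (tF a)) (metric_sumr hg) // => [|c].
    by apply: eq_bigr => c _; rewrite (metricZr hg).
  exact: tangentZ.
- by move=> b; exact: (on_frame_coord_smooth hg fG (sF a)).
- exact: on_frame_spanned fG.
- by apply: filterS2 nG (sF a).1 => q; exact: on_basis_expand.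
Qed.

(** Skew-adjointness of the curvature exhibits the vector dual to Ric(X, .). *)
Lemma ricci_sharp p (F : 'I_m -> vfield R M) X : on_frame g p F ->
  smooth_field_at p X -> tangent p (sharp g p (fun Y => ricci g D F X Y p)) /\
  forall Y, smooth_field_at p Y ->
    g p (sharp g p (fun Y => ricci g D F X Y p)) (Y p) = ricci g D F X Y p.
Proof.
move=> fF sX; have [sF nF] := fF; have bF := nbhs_singleton nF.
have tC a : tangent p (curvature D (F a) X (F a) p) by exact: curvature_tangent.
have tw : tangent p (- \sum_a curvature D (F a) X (F a) p).
  by apply: tangentN; exact: tangent_sum.
have wE Y : smooth_field_at p Y ->
    g p (- \sum_a curvature D (F a) X (F a) p) (Y p) = ricci g D F X Y p.
  move=> sY; have tY := smooth_field_tangent sY.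
  rewrite (metricNl hg) //; last exact: tangent_sum.
  rewrite (metric_suml hg) // -sumrN; apply: eq_bigr => a _.
  have tCY : tangent p (curvature D (F a) X Y p) by exact: curvature_tangent.
  rewrite (curvature_skew (on_frame_spanned fF) (sF a) sX (sF a) sY) opprK.
  by rewrite g_sym //; exact: smooth_field_tangent.
by rewrite (sharpE hg sF bF tw wE).
Qed.

(** The Christoffel terms recombine into g(X, D F_j) because the connection form of
    an orthonormal frame is skew. *)
Lemma cov_componentE p (F : 'I_m -> vfield R M) X i j : on_frame g p F ->
  smooth_field_at p X ->
  cov_component g D F X p i j = g p (cov D (F i) X p) (F j p).
Proof.
move=> fF sX; have [sF nF] := fF; have bF := nbhs_singleton nF.
have tF a : tangent p (F a p) by exact: smooth_field_tangent.
have tX := smooth_field_tangent sX.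
have tDF a : tangent p (cov D (F i) (F a) p) by exact: cov_tangent.
have tDFj : tangent p (D p (F i p) (F j)) := tDF j.
have skew b : g p (cov D (F i) (F b) p) (F j p) = - g p (cov D (F i) (F j) p) (F b p).
  have := levi_civita_metric (tF i) (sF b) (sF j).
  rewrite (tangent_near (tF i) (f' := fun=> (b == j)%:R)).
  - rewrite (tangent_cst _ (tF i)) => /esym/eqP; rewrite addr_eq0 => /eqP ->.
    by rewrite g_sym.
  - exact: (on_frame_coord_smooth hg fF (sF b)).
  - by apply: filterS nF => q [].
rewrite /cov_component (levi_civita_metric (tF i) sX (sF j)) -addrA.
rewrite [X in _ + X](_ : _ = 0) ?addr0 //.
under eq_bigr => b _ do rewrite skew mulNr.
rewrite sumrN; apply/eqP; rewrite subr_eq0; apply/eqP.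
rewrite {1}(on_basis_expand hg bF tX) (metric_suml hg) // => [|b]; last exact: tangentZ.
by apply: eq_bigr => b _; rewrite (metricZl hg) // mulrC g_sym.
Qed.

End LeviCivita.

(** * Differentials and extensions of vector fields *)

Section Differentials.
Context {R : realType} {m m' : nat} {M : manifold R m} {Mt : manifold R m'}.
Variable iota : M -> Mt.
Hypothesis siota : smooth_map iota.
Implicit Types (p q : M).

Lemma near_iota p (P : Mt -> Prop) : (\forall Q \near iota p, P Q) ->
  \forall q \near p, P (iota q).
Proof. by move=> nP; exact: (siota.1 p _ nP). Qed.

Lemma smooth_at_iota p (f : Mt -> R) : smooth_at (iota p) f ->
  smooth_at p (fun q => f (iota q)).
Proof. by move: p f; exact: siota.2. Qed.

Lemma differentialE p (x : vec R M) (f : Mt -> R) : smooth_at (iota p) f ->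
  differential iota p x f = x (fun q => f (iota q)).
Proof. by move=> sf; rewrite /differential asboolT. Qed.

Lemma differential_tangent p (x : vec R M) : tangent p x ->
  tangent (iota p) (differential iota p x).
Proof.
move=> tx; split.
- by move=> f nf; rewrite /differential asboolF.
- move=> f f' sf sf' ff'; rewrite !differentialE //.
  by apply: (tangent_near tx); [exact: smooth_at_iota|exact: (near_iota ff')].
- move=> a f f' sf sf'; rewrite !differentialE //; last first.
    by apply: smooth_atD => //; apply: smooth_atM => //; exact: smooth_at_cst.
  by case: tx => _ _ + _; apply; exact: smooth_at_iota.
- move=> f f' sf sf'; rewrite !differentialE //; last exact: smooth_atM.
  by apply: (tangent_mul tx); exact: smooth_at_iota.
Qed.

Lemma differential_lin p (a : R) (x y : vec R M) :
  differential iota p (a *: x + y) = a *: differential iota p x + differential iota p y.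
Proof.
apply/funext => f; rewrite !(vecD, vecZ) /differential.
by case: asboolP => // _; rewrite mulr0 addr0.
Qed.

Lemma differentialD p (x y : vec R M) :
  differential iota p (x + y) = differential iota p x + differential iota p y.
Proof. by have := differential_lin p 1 x y; rewrite !scale1r. Qed.

Lemma differential0 p : differential iota p 0 = 0.
Proof.
have := differential_lin p (-1) 0 0; rewrite scaler0 addr0 scaleN1r.
by rewrite addNr.
Qed.

Lemma differentialZ p (a : R) (x : vec R M) :
  differential iota p (a *: x) = a *: differential iota p x.
Proof. by have := differential_lin p a x 0; rewrite differential0 !addr0. Qed.

Lemma differentialN p (x : vec R M) :
  differential iota p (- x) = - differential iota p x.
Proof. by rewrite -scaleN1r differentialZ scaleN1r. Qed.

Lemma differentialB p (x y : vec R M) :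
  differential iota p (x - y) = differential iota p x - differential iota p y.
Proof. by rewrite differentialD differentialN. Qed.

Lemma differential_sum p (I : Type) (r : seq I) (x : I -> vec R M) :
  differential iota p (\sum_(i <- r) x i) = \sum_(i <- r) differential iota p (x i).
Proof.
elim: r => [|i r IH]; first by rewrite !big_nil differential0.
by rewrite !big_cons differentialD IH.
Qed.

Lemma induced_sym_bilinear (gt : Mt -> vec R Mt -> vec R Mt -> R) :
  sym_bilinear gt -> sym_bilinear (induced_metric gt iota).
Proof.
move=> [gs gl]; split.
  by move=> p x y tx ty; apply: gs; exact: differential_tangent.
move=> p a x y z tx ty tz; rewrite /induced_metric differential_lin.
by apply: gl; exact: differential_tangent.
Qed.

Lemma extends_at_value p Yt (V : M -> vec R Mt) :
  extends_at iota p Yt V -> Yt (iota p) = V p.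
Proof. by move=> [_ /nbhs_singleton]. Qed.

Lemma extends_at_open p Yt (V : M -> vec R Mt) :
  (\forall Q \near iota p, spanned Q) -> extends_at iota p Yt V ->
  \forall q \near p, extends_at iota q Yt V.
Proof.
move=> sp [sY YV]; have := near_iota (smooth_field_open sp sY).
by apply: filterS2 (near_near YV) => q.
Qed.

(** Fields extended to the ambient manifold are related by iota to their
    extensions, hence so are their Lie brackets. *)
Lemma lie_bracket_related p (X Y : vfield R M) (Xt Yt : vfield R Mt) :
  smooth_field_at p X -> smooth_field_at p Y ->
  extends_at iota p Xt (fun q => differential iota q (X q)) ->
  extends_at iota p Yt (fun q => differential iota q (Y q)) ->
  lie_bracket Xt Yt (iota p) = differential iota p (lie_bracket X Y p).
Proof.
move=> sX sY eX eY; apply/funext => f.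
rewrite /differential /lie_bracket; case: asboolP => // sf.
rewrite asboolT; last exact: smooth_at_iota.
have half (U V : vfield R M) (Ut Vt : vfield R Mt) : smooth_field_at p U ->
    extends_at iota p Ut (fun q => differential iota q (U q)) ->
    extends_at iota p Vt (fun q => differential iota q (V q)) ->
    Ut (iota p) (fun Q => Vt Q f) = U p (fun q => V q (fun q' => f (iota q'))).
  move=> sU eU [sV VE]; rewrite (extends_at_value eU).
  have sVf : smooth_at (iota p) (fun Q => Vt Q f) by exact: smooth_fieldP.
  rewrite differentialE //; apply: (tangent_near (smooth_field_tangent sU)).
    exact: (smooth_at_iota sVf).
  near=> q; have -> : Vt (iota q) = differential iota q (V q) by near: q.
  by rewrite differentialE //; near: q; exact: (near_iota (smooth_at_open sf)).
by rewrite !(half X Y Xt Yt, half Y X Yt Xt).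
Unshelve. all: by end_near. Qed.

End Differentials.

(** * Adapted frames and the second fundamental form *)

Section Submanifold.
Context {R : realType} {n k : nat} {M : manifold R n} {Mt : manifold R (n + k)}.
Variables (gt : Mt -> vec R Mt -> vec R Mt -> R).
Variables (Dt : Mt -> vec R Mt -> vfield R Mt -> vec R Mt).
Variables (D : M -> vec R M -> vfield R M -> vec R M) (iota : M -> Mt).
Hypothesis hgt : riemannian_metric gt.
Hypothesis hDt : levi_civita gt Dt.
Hypothesis siota : smooth_map iota.
Hypothesis hD : levi_civita (induced_metric gt iota) D.

Local Notation g := (induced_metric gt iota).
Local Notation d := (differential iota).
Local Notation II := (second_ff gt Dt iota).
Local Notation W := (weingarten gt Dt iota).

Lemma riemannian_sym_bilinear : sym_bilinear gt.
Proof. by case: hgt. Qed.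
Let fgt := riemannian_sym_bilinear.
Let fg : sym_bilinear g := induced_sym_bilinear siota fgt.
Let cDt := levi_civita_connection hDt.
Let cD := levi_civita_connection hD.

Lemma riemannian_smooth Q X Y : smooth_field_at Q X -> smooth_field_at Q Y ->
  smooth_at Q (fun Q' => gt Q' (X Q') (Y Q')).
Proof. by case: hgt => _ _ _; exact. Qed.

Definition ambient_frame (Et : 'I_n -> vfield R Mt) (N : 'I_k -> vfield R Mt)
    (a : 'I_(n + k)) : vfield R Mt :=
  match fintype.split a with inl i => Et i | inr l => N l end.

(** The hypotheses on frames at one point p; they are open in p (adapted_open), so
    that identities proved at p hold along the submanifold near p and can be
    differentiated. *)
Record adapted (E : 'I_n -> vfield R M) (Et : 'I_n -> vfield R Mt)
    (N : 'I_k -> vfield R Mt) (p : M) : Prop := Adapted {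
  adapted_frame : on_frame g p E;
  adapted_ext : forall i, extends_at iota p (Et i) (fun q => d q (E i q));
  adapted_normal : \forall q \near p, on_normal_basis gt iota q (fun l => N l (iota q));
  adapted_ambient : on_frame gt (iota p) (ambient_frame Et N)
}.

Variables (E : 'I_n -> vfield R M) (Et : 'I_n -> vfield R Mt) (N : 'I_k -> vfield R Mt).
Local Notation adaptedAt := (adapted E Et N).

Lemma on_frame_open (m : nat) (L : manifold R m) (gL : L -> vec R L -> vec R L -> R)
    (p : L) (G : 'I_m -> vfield R L) :
  on_frame gL p G -> \forall q \near p, on_frame gL q G.
Proof.
move=> fG; have [sG nG] := fG.
have sGq : \forall q \near p, forall i, smooth_field_at q (G i).
  apply: near_forall_fin => i; apply: smooth_field_open => //.
  exact: on_frame_spanned fG.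
by apply: filterS2 sGq (near_near nG) => q.
Qed.

Lemma adapted_spanned p : adaptedAt p -> \forall Q \near iota p, spanned Q.
Proof. by move=> [_ _ _ /on_frame_spanned]. Qed.

Lemma adapted_open p : adaptedAt p -> \forall q \near p, adaptedAt q.
Proof.
move=> hA; have [fE eE nN fG] := hA.
have nE := on_frame_open fE.
have nG := near_iota siota (on_frame_open fG).
have nEt : \forall q \near p, forall i,
    extends_at iota q (Et i) (fun q => d q (E i q)).
  by apply: near_forall_fin => i; apply: extends_at_open => //; exact: adapted_spanned.
by near=> q; split; near: q => //; exact: near_near.
Unshelve. all: by end_near. Qed.

Section AtPoint.
Variable p : M.
Hypothesis hA : adaptedAt p.
Local Notation P := (iota p).

Let bE : on_basis g p (E ^~ p).
Proof. exact: nbhs_singleton hA.(adapted_frame).2. Qed.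

Lemma adapted_smooth_E i : smooth_field_at p (E i).
Proof. by have [[]] := hA. Qed.

Lemma adapted_smooth_Et i : smooth_field_at P (Et i).
Proof. by have [_ /(_ i)[]] := hA. Qed.

Lemma adapted_smooth_N l : smooth_field_at P (N l).
Proof.
have [_ _ _ [/(_ (rshift n l)) + _]] := hA.
by rewrite /ambient_frame -[rshift n l]/(unsplit (inr l)) unsplitK.
Qed.

Lemma adapted_tangent_E i : tangent p (E i p).
Proof. exact: smooth_field_tangent (adapted_smooth_E i). Qed.

Lemma adapted_Et i : Et i P = d p (E i p).
Proof. exact: extends_at_value (adapted_ext hA i). Qed.

Lemma adapted_tangent_N l : tangent P (N l P).
Proof. exact: smooth_field_tangent (adapted_smooth_N l). Qed.

Lemma adapted_normal_N l x : tangent p x -> gt P (N l P) (d p x) = 0.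
Proof.
by move=> tx; have [_ _ /nbhs_singleton[nN _ _] _] := hA; exact: (nN l).2.
Qed.

Let tE := adapted_tangent_E.
Let tN := adapted_tangent_N.
Let tdE i : tangent P (d p (E i p)) := differential_tangent siota (tE i).

Lemma ambient_expand z : tangent P z ->
  z = \sum_i gt P z (d p (E i p)) *: d p (E i p) + \sum_l gt P z (N l P) *: N l P.
Proof.
move=> tz; rewrite {1}(on_basis_expand fgt (nbhs_singleton (adapted_ambient hA).2) tz).
rewrite big_split_ord /ambient_frame; congr (_ + _); apply: eq_bigr => i _.
  by rewrite -[lshift k i]/(unsplit (inl i)) unsplitK adapted_Et.
by rewrite -[rshift n i]/(unsplit (inr i)) unsplitK.
Qed.

(** The induced metric is nondegenerate on T_p M, which determines the vector that
    the definition of the orthogonal projection selects. *)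
Lemma tangential_part_unique z y : tangent P z -> tangent p y ->
  (forall x, tangent p x -> gt P (z - d p y) (d p x) = 0) ->
  tangential_part gt iota p z = y.
Proof.
move=> tz ty zy; rewrite /tangential_part.
case: xgetP => [w _ [tw zw]|/(_ y)[]//]; apply: (on_basis_ext fg bE) => // i.
have tdw := differential_tangent siota tw; have tdy := differential_tangent siota ty.
have := zy _ (tE i); rewrite -(zw _ (tE i)) !(metricBl fgt) //.
by move/addrI/oppr_inj.
Qed.

Lemma tangential_partE z : tangent P z ->
  tangential_part gt iota p z = \sum_i gt P z (d p (E i p)) *: E i p.
Proof.
move=> tz; have ts : tangent p (\sum_i gt P z (d p (E i p)) *: E i p).
  by apply: tangent_sum => i; exact: tangentZ.
apply: tangential_part_unique => // x tx.
have -> : z - d p (\sum_i gt P z (d p (E i p)) *: E i p) = \sum_l gt P z (N l P) *: N l P.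
  rewrite {1}(ambient_expand tz) differential_sum.
  under [X in _ - X]eq_bigr => i _ do rewrite differentialZ.
  by rewrite addrC addrA addNr add0r.
have tdx := differential_tangent siota tx.
rewrite (metric_suml fgt) // => [|l]; last exact: tangentZ.
by rewrite big1 // => l _; rewrite (metricZl fgt) // adapted_normal_N // mulr0.
Qed.

Lemma normal_partE z : tangent P z ->
  normal_part gt iota p z = \sum_l gt P z (N l P) *: N l P.
Proof.
move=> tz; rewrite /normal_part tangential_partE // {1}(ambient_expand tz).
rewrite differential_sum; under [X in _ - X]eq_bigr => i _ do rewrite differentialZ.
by rewrite addrC addrA addNr add0r.
Qed.

Lemma ambient_decomp z : z = d p (tangential_part gt iota p z) + normal_part gt iota p z.
Proof. by rewrite /normal_part addrC subrK. Qed.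

Lemma tangential_part_tangent z : tangent P z -> tangent p (tangential_part gt iota p z).
Proof.
by move=> tz; rewrite tangential_partE //; apply: tangent_sum => i; exact: tangentZ.
Qed.

Lemma normal_part_tangent z : tangent P z -> tangent P (normal_part gt iota p z).
Proof.
by move=> tz; rewrite normal_partE //; apply: tangent_sum => i; exact: tangentZ.
Qed.

Lemma normal_part_sum (I : finType) (z : I -> vec R Mt) : (forall i, tangent P (z i)) ->
  normal_part gt iota p (\sum_i z i) = \sum_i normal_part gt iota p (z i).
Proof.
move=> tz; rewrite normal_partE; last exact: tangent_sum.
under eq_bigr => l _ do rewrite (metric_suml fgt) // scaler_suml.
by rewrite exchange_big; apply: eq_bigr => i _; rewrite normal_partE.
Qed.

Lemma normal_partZ a z : tangent P z ->
  normal_part gt iota p (a *: z) = a *: normal_part gt iota p z.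
Proof.
move=> tz; rewrite !normal_partE //; last exact: tangentZ.
by rewrite scaler_sumr; apply: eq_bigr => l _; rewrite (metricZl fgt) // scalerA.
Qed.

Lemma normal_partD y z : tangent P y -> tangent P z ->
  normal_part gt iota p (y + z) = normal_part gt iota p y + normal_part gt iota p z.
Proof.
move=> ty tz; rewrite !normal_partE //; last exact: tangentD.
by rewrite -big_split; apply: eq_bigr => l _; rewrite (metricDl fgt) // scalerDl.
Qed.

Lemma normal_partN z : tangent P z ->
  normal_part gt iota p (- z) = - normal_part gt iota p z.
Proof. by move=> tz; rewrite -scaleN1r normal_partZ // scaleN1r. Qed.

Lemma normal_part_differential x : tangent p x -> normal_part gt iota p (d p x) = 0.
Proof.
move=> tx; have tdx := differential_tangent siota tx.
rewrite normal_partE // big1 // => l _.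
by rewrite (fgt.1 _ _ _ tdx (tN l)) adapted_normal_N // scale0r.
Qed.

Lemma normal_part_id z : tangent P z ->
  normal_part gt iota p (normal_part gt iota p z) = normal_part gt iota p z.
Proof.
move=> tz; have tt := tangential_part_tangent tz; have tn := normal_part_tangent tz.
have := ambient_decomp z => /(congr1 (normal_part gt iota p)).
rewrite normal_partD // ?normal_part_differential ?add0r //.
exact: differential_tangent.
Qed.

(** Along the submanifold, only the values of a field there matter for its
    covariant derivative in a tangential direction: expand it in a frame. *)
Lemma ambient_conn_along x Y Z : tangent p x -> smooth_field_at P Y ->
  smooth_field_at P Z -> (\forall q \near p, Y (iota q) = Z (iota q)) ->
  Dt P (d p x) Y = Dt P (d p x) Z.
Proof.
move=> tx sY sZ YZ; have fG := adapted_ambient hA; have [sG nG] := fG.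
have tdx := differential_tangent siota tx.
have expand X : smooth_field_at P X -> Dt P (d p x) X =
    \sum_b (x (fun q => gt (iota q) (X (iota q)) (ambient_frame Et N b (iota q)))
      *: ambient_frame Et N b P
      + gt P (X P) (ambient_frame Et N b P) *: Dt P (d p x) (ambient_frame Et N b)).
  move=> sX; pose a b Q := gt Q (X Q) (ambient_frame Et N b Q).
  have sa b : smooth_at P (a b) by exact: riemannian_smooth.
  rewrite (conn_near cDt (Z := fun Q => \sum_b a b Q *: ambient_frame Et N b Q) tdx sX).
    rewrite (conn_combr cDt) //; apply: eq_bigr => b _.
    by rewrite differentialE.
  by apply: filterS2 nG sX.1 => Q; exact: on_basis_expand.
rewrite (expand _ sY) (expand _ sZ); apply: eq_bigr => b _.
rewrite (nbhs_singleton YZ); congr (_ *: _ + _).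
apply: (tangent_near tx).
  exact: (smooth_at_iota siota (riemannian_smooth sY (sG b))).
by apply: filterS YZ => q ->.
Qed.

(** Combining the E_i and their extensions with constant coefficients turns a
    tangent vector into a field with an ambient extension. *)
Lemma constant_extension y : tangent p y -> exists Y Yt,
  [/\ smooth_field_at p Y, Y p = y & extends_at iota p Yt (fun q => d q (Y q))].
Proof.
move=> ty; pose a i := g p y (E i p).
exists (fun q => \sum_i a i *: E i q), (fun Q => \sum_i a i *: Et i Q); split.
- apply: smooth_field_sum => i; apply: (smooth_fieldZ (f := fun=> a i)).
    exact: smooth_at_cst.
  exact: adapted_smooth_E.
- by rewrite -(on_basis_expand fg bE ty).
- split.
    apply: smooth_field_sum => i; apply: (smooth_fieldZ (f := fun=> a i)).
      exact: smooth_at_cst.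
    exact: adapted_smooth_Et.
  apply: filterS (adapted_open hA) => q Aq.
  rewrite differential_sum; apply: eq_bigr => i _.
  by rewrite differentialZ; congr (_ *: _); have [_ /(_ i)/extends_at_value] := Aq.
Qed.

(** The N_l component of II(x, y), in a form where bilinearity in (x, y) is
    apparent: differentiate the relation gt(Y, N_l) = 0 along x. *)
Definition normal_form l x y : R := - gt P (d p y) (Dt P (d p x) (N l)).

Lemma conn_normal_component l x y Y : tangent p x -> smooth_field_at P Y ->
  Y P = d p y ->
  (\forall q \near p, exists2 z, tangent q z & Y (iota q) = d q z) ->
  gt P (Dt P (d p x) Y) (N l P) = normal_form l x y.
Proof.
move=> tx sY Yy tY; have tdx := differential_tangent siota tx.
have sN := adapted_smooth_N l.
have := levi_civita_metric hDt tdx sY sN; rewrite differentialE; last first.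
  exact: riemannian_smooth.
have -> : x (fun q => gt (iota q) (Y (iota q)) (N l (iota q))) = 0.
  rewrite -(tangent_cst 0 tx); apply: (tangent_near tx).
    exact: (smooth_at_iota siota (riemannian_smooth sY sN)).
  apply: filterS2 tY (adapted_normal hA) => q [z tz ->] [nN _ _].
  rewrite fgt.1; [exact: (nN l).2|exact: differential_tangent|exact: (nN l).1].
by move/esym/eqP; rewrite addr_eq0 Yy => /eqP.
Qed.

Lemma second_ffE x y : tangent p x -> tangent p y ->
  II p x y = \sum_l normal_form l x y *: N l P.
Proof.
move=> tx ty; have tdx := differential_tangent siota tx.
suff [Y [sY YE tY]] : exists Y, [/\ smooth_field_at P Y, Y P = d p y &
    \forall q \near p, exists2 z, tangent q z & Y (iota q) = d q z].
  rewrite /second_ff /tangent_extension; case: xgetP => [Z _ [sZ ZE tZ]|/(_ Y)[]//].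
  rewrite normal_partE; last exact: conn_tangent.
  by apply: eq_bigr => l _; rewrite (conn_normal_component l tx sZ ZE tZ).
have [Y [Yt [sY Yp [sYt YE]]]] := constant_extension ty.
exists Yt; split=> //; first by rewrite (nbhs_singleton YE) Yp.
by apply: filterS2 sY.1 YE => q tYq ->; exists (Y q).
Qed.

Lemma second_ff_tangent x y : tangent p x -> tangent p y -> tangent P (II p x y).
Proof.
by move=> tx ty; rewrite second_ffE //; apply: tangent_sum => l; exact: tangentZ.
Qed.

Lemma second_ff_orth x y z : tangent p x -> tangent p y -> tangent p z ->
  gt P (II p x y) (d p z) = 0.
Proof.
move=> tx ty tz; rewrite second_ffE // (metric_suml fgt) => [|l|].
- by rewrite big1 // => l _; rewrite (metricZl fgt) ?adapted_normal_N ?mulr0 //;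
     exact: differential_tangent.
- exact: tangentZ.
- exact: differential_tangent.
Qed.

Lemma normal_part_second_ff x y : tangent p x -> tangent p y ->
  normal_part gt iota p (II p x y) = II p x y.
Proof.
move=> tx ty; rewrite {2}(ambient_decomp (II p x y)).
rewrite (_ : tangential_part _ _ _ _ = 0) ?differential0 ?add0r //.
apply: tangential_part_unique; first exact: second_ff_tangent.
  exact: tangent0.
by move=> z tz; rewrite differential0 subr0 second_ff_orth.
Qed.

Lemma second_ff_combl (I : finType) (a : I -> R) (x : I -> vec R M) y :
  (forall i, tangent p (x i)) -> tangent p y ->
  II p (\sum_i a i *: x i) y = \sum_i a i *: II p (x i) y.
Proof.
move=> tx ty; rewrite second_ffE //; last by apply: tangent_sum => i; exact: tangentZ.
under [RHS]eq_bigr => i _ do rewrite second_ffE // scaler_sumr.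
rewrite exchange_big; apply: eq_bigr => l _ /=.
under [RHS]eq_bigr => i _ do rewrite scalerA.
rewrite -scaler_suml; congr (_ *: _).
have tdx i := differential_tangent siota (tx i).
have tdy := differential_tangent siota ty.
rewrite /normal_form differential_sum.
rewrite (conn_suml cDt) //; last 2 first.
- by move=> i; rewrite differentialZ; exact: tangentZ.
- exact: adapted_smooth_N.
have tD i : tangent P (Dt P (d p (x i)) (N l)).
  by apply: (conn_tangent cDt) => //; exact: adapted_smooth_N.
rewrite (eq_bigr (fun i => a i *: Dt P (d p (x i)) (N l))); last first.
  by move=> i _; rewrite differentialZ (connZl cDt) //; exact: adapted_smooth_N.
rewrite (metric_sumr fgt) //; last by move=> i; exact: tangentZ.
rewrite -sumrN; apply: eq_bigr => i _.
by rewrite (metricZr fgt) // mulrN.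
Qed.

Lemma second_ffBl x x' y : tangent p x -> tangent p x' -> tangent p y ->
  II p (x - x') y = II p x y - II p x' y.
Proof.
move=> tx tx' ty.
have := @second_ff_combl 'I_2 (fun i => if i == 0 then 1 else -1)
  (fun i => if i == 0 then x else x') y.
rewrite !big_ord_recl !big_ord0 /= !addr0 !scale1r !scaleN1r; apply=> //.
by move=> i; case: (_ == _).
Qed.

(** Extensions of two fields on M have a bracket tangent to M, and Dt is torsion
    free. *)
Lemma second_ff_sym x y : tangent p x -> tangent p y -> II p x y = II p y x.
Proof.
move=> tx ty; rewrite !second_ffE //; apply: eq_bigr => l _; congr (_ *: _).
have [X [Xt [sX Xp eX]]] := constant_extension tx.
have [Y [Yt [sY Yp eY]]] := constant_extension ty.
have tng Z Zt : smooth_field_at p Z -> extends_at iota p Zt (fun q => d q (Z q)) ->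
    \forall q \near p, exists2 z, tangent q z & Zt (iota q) = d q z.
  by move=> sZ [_ eZ]; apply: filterS2 sZ.1 eZ => q tZ ->; exists (Z q).
have vX : Xt P = d p x by rewrite (extends_at_value eX) Xp.
have vY : Yt P = d p y by rewrite (extends_at_value eY) Yp.
rewrite -(conn_normal_component l tx eY.1 vY (tng _ _ sY eY)).
rewrite -(conn_normal_component l ty eX.1 vX (tng _ _ sX eX)).
have tXY := cov_tangent cDt eX.1 eY.1; have tYX := cov_tangent cDt eY.1 eX.1.
apply/eqP; rewrite -subr_eq0 -vX -vY -(metricBl fgt) //.
rewrite -[Dt P _ _ - _]/(cov Dt Xt Yt P - cov Dt Yt Xt P) -(levi_civita_torsion hDt eX.1 eY.1).
have tB := lie_bracket_tangent hD sX sY.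
rewrite (lie_bracket_related siota sX sY eX eY) fgt.1 //; first last.
  exact: differential_tangent.
by rewrite adapted_normal_N.
Qed.

Lemma second_ff_combr (I : finType) (a : I -> R) (x : I -> vec R M) y :
  (forall i, tangent p (x i)) -> tangent p y ->
  II p y (\sum_i a i *: x i) = \sum_i a i *: II p y (x i).
Proof.
move=> tx ty; rewrite second_ff_sym //; last first.
  by apply: tangent_sum => i; exact: tangentZ.
by rewrite second_ff_combl //; apply: eq_bigr => i _; rewrite second_ff_sym.
Qed.

(** The tangential part of Dt is a torsion-free metric connection on fields that
    extend to the ambient manifold, hence is D by Koszul's argument. *)
Lemma koszul X Y Z Xt Yt Zt :
  smooth_field_at p X -> smooth_field_at p Y -> smooth_field_at p Z ->
  extends_at iota p Xt (fun q => d q (X q)) ->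
  extends_at iota p Yt (fun q => d q (Y q)) ->
  extends_at iota p Zt (fun q => d q (Z q)) ->
  gt P (Dt P (d p (X p)) Yt) (d p (Z p)) = g p (D p (X p) Y) (Z p).
Proof.
pose C (U V T : vfield R M) (Vt : vfield R Mt) :=
  gt P (Dt P (d p (U p)) Vt) (d p (T p)) - g p (D p (U p) V) (T p).
have skew U V T Ut Vt Tt :
    smooth_field_at p U -> smooth_field_at p V -> smooth_field_at p T ->
    extends_at iota p Ut (fun q => d q (U q)) ->
    extends_at iota p Vt (fun q => d q (V q)) ->
    extends_at iota p Tt (fun q => d q (T q)) -> C U V T Vt = - C U T V Tt.
  move=> sU sV sT eU eV eT; have tU := smooth_field_tangent sU.
  have tdU := differential_tangent siota tU.
  have tV := smooth_field_tangent sV; have tT := smooth_field_tangent sT.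
  have tdV := differential_tangent siota tV.
  have svt := riemannian_smooth eV.1 eT.1.
  have := levi_civita_metric hDt tdU eV.1 eT.1.
  rewrite differentialE // (tangent_near tU (f' := fun q => g q (V q) (T q))); last 2 first.
  - exact: (smooth_at_iota siota svt).
  - by apply: filterS2 eV.2 eT.2 => q -> ->.
  rewrite (levi_civita_metric hD tU sV sT).
  rewrite (extends_at_value eV) (extends_at_value eT) /C => e.
  have tDT : tangent p (D p (U p) T) by exact: (conn_tangent cD).
  have tDTt : tangent P (Dt P (d p (U p)) Tt) by apply: (conn_tangent cDt) => //; exact: eT.1.
  rewrite [gt P _ (d p (V p))]fgt.1 // [g p _ (V p)]fg.1 //.
  by apply/eqP; rewrite -subr_eq0 opprK addrACA -e -opprD subrr.
have sym U V T Ut Vt :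
    smooth_field_at p U -> smooth_field_at p V -> smooth_field_at p T ->
    extends_at iota p Ut (fun q => d q (U q)) ->
    extends_at iota p Vt (fun q => d q (V q)) -> C U V T Vt = C V U T Ut.
  move=> sU sV sT eU eV.
  have tT := smooth_field_tangent sT; have tdT := differential_tangent siota tT.
  have tUV := cov_tangent cD sU sV; have tVU := cov_tangent cD sV sU.
  have ttUV := cov_tangent cDt eU.1 eV.1; have ttVU := cov_tangent cDt eV.1 eU.1.
  have := lie_bracket_related siota sU sV eU eV.
  rewrite (levi_civita_torsion hDt eU.1 eV.1) (levi_civita_torsion hD sU sV).
  move/(congr1 (fun w => gt P w (d p (T p)))).
  rewrite (metricBl fgt) // -[RHS]/(g p _ (T p)) (metricBl fg) // /cov.
  rewrite (extends_at_value eU) (extends_at_value eV) /C => AB.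
  have swap (a b a' b' : R) : a - b = a' - b' -> a - a' = b - b'.
    by move=> e; rewrite -[a](subrK b) e; ring.
  exact: swap.
move=> sX sY sZ eX eY eZ; apply/eqP; rewrite -subr_eq0 -/(C X Y Z Yt).
have : C X Y Z Yt = - C X Y Z Yt.
  rewrite {1}(sym X Y Z Xt Yt) // (skew Y X Z Yt Xt Zt) // (sym Y Z X Yt Zt) //.
  by rewrite (skew Z Y X Zt Yt Xt) // opprK (sym Z X Y Zt Xt) // (skew X Z Y Xt Zt Yt).
by move/eqP; rewrite -subr_eq0 opprK -mulr2n mulrn_eq0.
Qed.

Lemma conn_tangential_part x Y Yt : tangent p x -> smooth_field_at p Y ->
  extends_at iota p Yt (fun q => d q (Y q)) ->
  tangential_part gt iota p (Dt P (d p x) Yt) = D p x Y.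
Proof.
move=> tx sY eY; have tdx := differential_tangent siota tx.
have tDt : tangent P (Dt P (d p x) Yt) by apply: (conn_tangent cDt) => //; exact: eY.1.
have tD : tangent p (D p x Y) by exact: (conn_tangent cD).
have tdD := differential_tangent siota tD.
apply: tangential_part_unique => // z tz; have tdz := differential_tangent siota tz.
have [X [Xt [sX <- eX]]] := constant_extension tx.
have [Z [Zt [sZ <- eZ]]] := constant_extension tz.
have tdX := differential_tangent siota (smooth_field_tangent sX).
have tdZ := differential_tangent siota (smooth_field_tangent sZ).
rewrite (metricBl fgt) //; last 2 first.
- by apply: (conn_tangent cDt) => //; exact: eY.1.
- by apply: differential_tangent => //; apply: (conn_tangent cD) => //;
     exact: smooth_field_tangent.
by rewrite (koszul sX sY sZ eX eY eZ) subrr.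
Qed.

(** Gauss formula: Koszul's argument gives the tangential part, and the normal part
    does not depend on the field chosen to extend Y_p in the definition of II. *)
Lemma gauss_formula x Y Yt : tangent p x -> smooth_field_at p Y ->
  extends_at iota p Yt (fun q => d q (Y q)) ->
  Dt P (d p x) Yt = d p (D p x Y) + II p x (Y p).
Proof.
move=> tx sY eY; have tdx := differential_tangent siota tx.
rewrite [LHS]ambient_decomp (conn_tangential_part tx sY eY); congr (_ + _).
rewrite normal_partE; last by apply: (conn_tangent cDt) => //; exact: eY.1.
rewrite second_ffE //; last exact: smooth_field_tangent.
apply: eq_bigr => l _; congr (_ *: _).
apply: conn_normal_component => //; [exact: eY.1|exact: extends_at_value eY|].
by apply: filterS2 sY.1 eY.2 => q tY ->; exists (Y q).
Qed.

Lemma weingartenE eta x : tangent P eta -> tangent p x ->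
  W p eta x = \sum_i gt P eta (II p x (E i p)) *: E i p.
Proof.
move=> teta tx; apply: (sharpE fg adapted_smooth_E bE).
  by apply: tangent_sum => i; exact: tangentZ.
move=> Y sY; have tY := smooth_field_tangent sY.
rewrite {2}(on_basis_expand fg bE tY) second_ff_combr // (metric_sumr fgt) //; last first.
  by move=> i; apply: tangentZ; exact: second_ff_tangent.
rewrite (metric_suml fg) //; last by move=> i; exact: tangentZ.
apply: eq_bigr => i _; rewrite (metricZl fg) // (metricZr fgt) //; last first.
  exact: second_ff_tangent.
by rewrite mulrC; congr (_ * _); exact: fg.1.
Qed.

Lemma weingarten_tangent eta x : tangent P eta -> tangent p x -> tangent p (W p eta x).
Proof.
by move=> te tx; rewrite weingartenE //; apply: tangent_sum => i; exact: tangentZ.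
Qed.

(** Weingarten formula: differentiate the relation gt(eta, E_i) = 0 along M. *)
Lemma weingarten_formula eta x : smooth_field_at P eta -> tangent p x ->
  (\forall q \near p, forall y, tangent q y -> gt (iota q) (eta (iota q)) (d q y) = 0) ->
  Dt P (d p x) eta = - d p (W p (eta P) x) + normal_part gt iota p (Dt P (d p x) eta).
Proof.
move=> seta tx neta; have tdx := differential_tangent siota tx.
have tD : tangent P (Dt P (d p x) eta) by exact: (conn_tangent cDt).
have teta := smooth_field_tangent seta.
rewrite [LHS]ambient_decomp; congr (_ + _); rewrite -differentialN; congr (d p _).
rewrite tangential_partE // weingartenE // -sumrN; apply: eq_bigr => i _.
rewrite -scaleNr; congr (_ *: _).
have eE := adapted_ext hA i.
have := levi_civita_metric hDt tdx seta eE.1; rewrite differentialE; last first.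
  exact: (riemannian_smooth seta eE.1).
have -> : x (fun q => gt (iota q) (eta (iota q)) (Et i (iota q))) = 0.
  rewrite -(tangent_cst 0 tx); apply: (tangent_near tx).
    exact: (smooth_at_iota siota (riemannian_smooth seta eE.1)).
  apply: filterS3 neta (adapted_smooth_E i).1 eE.2 => q orth tEq ->; exact: orth.
rewrite adapted_Et (gauss_formula tx (adapted_smooth_E i) eE).
have tDE : tangent p (D p x (E i)) by apply: (conn_tangent cD) => //; exact: adapted_smooth_E.
rewrite (metricDr fgt) //; last 2 first.
- exact: differential_tangent.
- exact: second_ff_tangent.
rewrite (nbhs_singleton neta) // add0r => /esym/eqP.
by rewrite addr_eq0 => /eqP.
Qed.

(** The extension selected in the definition of the normal connection may be
    replaced by any other one, by ambient_conn_along. *)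
Lemma normal_connectionE x eta V : tangent p x -> extends_at iota p eta V ->
  normal_connection gt Dt iota p x V = normal_part gt iota p (Dt P (d p x) eta).
Proof.
move=> tx [seta eeta]; rewrite /normal_connection.
case: xgetP => [Y _ [sY eY]|/(_ eta)[]//]; congr (normal_part _ _ _ _).
by apply: ambient_conn_along => //; apply: filterS2 eY eeta => q -> ->.
Qed.

End AtPoint.
End Submanifold.

(** * Second derivatives and the Codazzi equation *)

Section SecondDerivatives.
Context {R : realType} {n k : nat} {M : manifold R n} {Mt : manifold R (n + k)}.
Variables (gt : Mt -> vec R Mt -> vec R Mt -> R).
Variables (Dt : Mt -> vec R Mt -> vfield R Mt -> vec R Mt).
Variables (D : M -> vec R M -> vfield R M -> vec R M) (iota : M -> Mt).
Hypothesis hgt : riemannian_metric gt.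
Hypothesis hDt : levi_civita gt Dt.
Hypothesis siota : smooth_map iota.
Hypothesis hD : levi_civita (induced_metric gt iota) D.
Variables (E : 'I_n -> vfield R M) (Et : 'I_n -> vfield R Mt) (N : 'I_k -> vfield R Mt).
Variable p : M.
Hypothesis hA : adapted gt iota E Et N p.

Local Notation g := (induced_metric gt iota).
Local Notation d := (differential iota).
Local Notation II := (second_ff gt Dt iota).
Local Notation W := (weingarten gt Dt iota).
Local Notation P := (iota p).
Local Notation ext X Xt := (extends_at iota p Xt (fun q => d q (X q))).
Local Notation NC := (normal_connection gt Dt iota p).

Let fgt := riemannian_sym_bilinear hgt.
Let fg : sym_bilinear g := induced_sym_bilinear siota fgt.
Let cDt := levi_civita_connection hDt.
Let cD := levi_civita_connection hD.
Let sE := adapted_smooth_E hA.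
Let sEt := adapted_smooth_Et hA.
Let sN := adapted_smooth_N hA.
Let eE := adapted_ext hA.
Let tE := adapted_tangent_E hA.
Let bE : on_basis g p (E ^~ p).
Proof. exact: nbhs_singleton hA.(adapted_frame).2. Qed.
Let spM : \forall q \near p, spanned q.
Proof. exact: on_frame_spanned hA.(adapted_frame). Qed.
Let spMt := adapted_spanned hA.

(** Local extensions of the fields d(D_X Y) and II(X, Y): the tangential and
    normal components of Dt_X Y in the adapted frame. *)
Definition tangential_extension (Xt Yt : vfield R Mt) : vfield R Mt := fun Q =>
  \sum_i gt Q (cov Dt Xt Yt Q) (Et i Q) *: Et i Q.

Definition normal_extension (Xt Yt : vfield R Mt) : vfield R Mt := fun Q =>
  \sum_l gt Q (cov Dt Xt Yt Q) (N l Q) *: N l Q.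

Lemma tangential_extension_smooth Xt Yt : smooth_field_at P Xt ->
  smooth_field_at P Yt -> smooth_field_at P (tangential_extension Xt Yt).
Proof.
move=> sX sY; apply: smooth_field_sum => i; apply: smooth_fieldZ => //.
by apply: (riemannian_smooth hgt) => //; exact: cov_smooth.
Qed.

Lemma normal_extension_smooth Xt Yt : smooth_field_at P Xt ->
  smooth_field_at P Yt -> smooth_field_at P (normal_extension Xt Yt).
Proof.
move=> sX sY; apply: smooth_field_sum => i; apply: smooth_fieldZ => //.
by apply: (riemannian_smooth hgt) => //; exact: cov_smooth.
Qed.

Lemma cov_split Xt Yt : smooth_field_at P Xt -> smooth_field_at P Yt ->
  \forall Q \near P, cov Dt Xt Yt Q =
    tangential_extension Xt Yt Q + normal_extension Xt Yt Q.
Proof.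
move=> sX sY; have sXY := cov_smooth cDt sX sY.
apply: filterS2 (adapted_ambient hA).2 sXY.1 => Q bQ tQ.
rewrite {1}(on_basis_expand fgt bQ tQ) big_split_ord /ambient_frame.
congr (_ + _); apply: eq_bigr => i _.
  by rewrite -[lshift k i]/(unsplit (inl i)) unsplitK.
by rewrite -[rshift n i]/(unsplit (inr i)) unsplitK.
Qed.

Lemma near_gauss X Y Xt Yt : smooth_field_at p X -> smooth_field_at p Y ->
  ext X Xt -> ext Y Yt ->
  \forall q \near p, [/\ adapted gt iota E Et N q, tangent q (X q),
    smooth_field_at q Y, tangent (iota q) (cov Dt Xt Yt (iota q)) &
    cov Dt Xt Yt (iota q) = d q (cov D X Y q) + II q (X q) (Y q)].
Proof.
move=> sX sY eX eY; near=> q.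
have Aq : adapted gt iota E Et N q by near: q; exact: adapted_open.
have tX : tangent q (X q) by near: q; exact: sX.1.
have sYq : smooth_field_at q Y by near: q; exact: smooth_field_open.
have eYq : extends_at iota q Yt (fun q => d q (Y q)).
  by near: q; exact: extends_at_open.
have Xq : Xt (iota q) = d q (X q) by near: q; exact: eX.2.
split=> //; rewrite /cov Xq.
  by apply: (conn_tangent cDt); [exact: differential_tangent|exact: eYq.1].
exact: (gauss_formula hgt hDt siota hD Aq).
Unshelve. all: by end_near. Qed.

Lemma tangential_extension_ext X Y Xt Yt :
  smooth_field_at p X -> smooth_field_at p Y -> ext X Xt -> ext Y Yt ->
  ext (cov D X Y) (tangential_extension Xt Yt).
Proof.
move=> sX sY eX eY; split; first exact: tangential_extension_smooth eX.1 eY.1.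
apply: filterS (near_gauss sX sY eX eY) => q [Aq tX sYq tC CE].
have tDq : tangent q (cov D X Y q) by exact: (conn_tangent cD).
have tY := smooth_field_tangent sYq.
have bEq := nbhs_singleton (adapted_frame Aq).2.
rewrite /tangential_extension [in RHS](on_basis_expand fg bEq tDq) differential_sum.
apply: eq_bigr => i _.
rewrite differentialZ (adapted_Et Aq); congr (_ *: _); rewrite CE.
have tEq := adapted_tangent_E Aq i.
rewrite (metricDl fgt) ?(second_ff_orth hgt hDt siota Aq) ?addr0 //.
- exact: differential_tangent.
- exact: (second_ff_tangent hgt hDt siota Aq).
- exact: differential_tangent.
Qed.

Lemma normal_extension_ext X Y Xt Yt :
  smooth_field_at p X -> smooth_field_at p Y -> ext X Xt -> ext Y Yt ->
  extends_at iota p (normal_extension Xt Yt) (fun q => II q (X q) (Y q)).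
Proof.
move=> sX sY eX eY; split; first exact: normal_extension_smooth eX.1 eY.1.
apply: filterS (near_gauss sX sY eX eY) => q [Aq tX sYq tC CE].
have tDq : tangent q (cov D X Y q) by exact: (conn_tangent cD).
have tY := smooth_field_tangent sYq.
have tII : tangent (iota q) (II q (X q) (Y q)).
  exact: (second_ff_tangent hgt hDt siota Aq).
rewrite /normal_extension -(normal_partE hgt siota Aq) // CE.
rewrite (normal_partD hgt siota Aq) //; last exact: differential_tangent.
rewrite (normal_part_differential hgt siota Aq) // add0r.
exact: (normal_part_second_ff hgt hDt siota Aq).
Qed.

Lemma near_second_ff_orth X Y : smooth_field_at p X -> smooth_field_at p Y ->
  \forall q \near p, forall z, tangent q z -> gt (iota q) (II q (X q) (Y q)) (d q z) = 0.
Proof.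
move=> sX sY; near=> q => z tz.
have Aq : adapted gt iota E Et N q by near: q; exact: adapted_open.
by apply: (second_ff_orth hgt hDt siota Aq) => //; near: q; [exact: sX.1|exact: sY.1].
Unshelve. all: by end_near. Qed.

Lemma normal_connection_second_ff x X Y Xt Yt : tangent p x ->
  smooth_field_at p X -> smooth_field_at p Y -> ext X Xt -> ext Y Yt ->
  NC x (fun q => II q (X q) (Y q)) =
  normal_part gt iota p (Dt P (d p x) (normal_extension Xt Yt)).
Proof.
move=> tx sX sY eX eY; apply: (normal_connectionE hgt hDt siota hA) => //.
exact: normal_extension_ext.
Qed.

(** Differentiating Dt_X Y = d(D_X Y) + II(X, Y) once more: the Gauss formula
    applies to the first term and the Weingarten formula to the second. *)
Lemma second_derivative x X Y Xt Yt : tangent p x ->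
  smooth_field_at p X -> smooth_field_at p Y -> ext X Xt -> ext Y Yt ->
  Dt P (d p x) (cov Dt Xt Yt) =
    d p (D p x (cov D X Y)) + II p x (cov D X Y p)
    - d p (W p (II p (X p) (Y p)) x) + NC x (fun q => II q (X q) (Y q)).
Proof.
move=> tx sX sY eX eY; have tdx := differential_tangent siota tx.
have st := tangential_extension_smooth eX.1 eY.1.
have sn := normal_extension_smooth eX.1 eY.1.
have en := normal_extension_ext sX sY eX eY.
rewrite (conn_near cDt tdx _ (cov_split eX.1 eY.1)); last first.
  exact: (cov_smooth cDt eX.1 eY.1).
rewrite (connDr cDt) //.
rewrite (gauss_formula hgt hDt siota hD hA tx (cov_smooth cD sX sY)); last first.
  exact: tangential_extension_ext.
rewrite (weingarten_formula hgt hDt siota hD hA (x := x) sn) //; last first.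
  by apply: filterS2 en.2 (near_second_ff_orth sX sY) => q ->.
rewrite (extends_at_value en) -(normal_connection_second_ff tx sX sY eX eY).
by rewrite !addrA.
Qed.

Lemma normal_connection_normal x X Y Xt Yt : tangent p x ->
  smooth_field_at p X -> smooth_field_at p Y -> ext X Xt -> ext Y Yt ->
  tangent P (NC x (fun q => II q (X q) (Y q))) /\
  normal_part gt iota p (NC x (fun q => II q (X q) (Y q))) =
    NC x (fun q => II q (X q) (Y q)).
Proof.
move=> tx sX sY eX eY.
rewrite (normal_connection_second_ff tx sX sY eX eY).
have tD : tangent P (Dt P (d p x) (normal_extension Xt Yt)).
  apply: (conn_tangent cDt); first exact: differential_tangent.
  exact: normal_extension_smooth eX.1 eY.1.
by split; [exact: (normal_part_tangent hgt siota hA)|exact: (normal_part_id hgt siota hA)].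
Qed.

(** Codazzi equation: take normal parts in second_derivative and antisymmetrize; the
    term in [X, Y] is absorbed by the torsion-freeness of D. *)
Lemma codazzi X Y Z Xt Yt Zt : smooth_field_at p X -> smooth_field_at p Y ->
  smooth_field_at p Z -> ext X Xt -> ext Y Yt -> ext Z Zt ->
  normal_part gt iota p (curvature Dt Xt Yt Zt P) =
  nablaB gt Dt iota D II X Y Z p - nablaB gt Dt iota D II Y X Z p.
Proof.
move=> sX sY sZ eX eY eZ.
have tX := smooth_field_tangent sX; have tY := smooth_field_tangent sY.
have tZ := smooth_field_tangent sZ.
have tXY := cov_tangent cD sX sY; have tYX := cov_tangent cD sY sX.
have tXZ := cov_tangent cD sX sZ; have tYZ := cov_tangent cD sY sZ.
have tB := tangentB tXY tYX.
have normal_second x U Ut : tangent p x -> smooth_field_at p U -> ext U Ut ->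
    normal_part gt iota p (Dt P (d p x) (cov Dt Ut Zt)) =
    II p x (cov D U Z p) + NC x (fun q => II q (U q) (Z q)).
  move=> tx sU eU; rewrite (second_derivative tx sU sZ eU eZ).
  have tU := smooth_field_tangent sU; have tUZ := cov_tangent cD sU sZ.
  have [tNC nNC] := normal_connection_normal tx sU sZ eU eZ.
  have tII := second_ff_tangent hgt hDt siota hA tx tUZ.
  have tII' := second_ff_tangent hgt hDt siota hA tU tZ.
  have tW := weingarten_tangent hgt hDt siota hD hA tII' tx.
  have tdW := differential_tangent siota tW.
  have tD2 : tangent p (D p x (cov D U Z)).
    by apply: (conn_tangent cD) => //; exact: cov_smooth.
  have tdD2 := differential_tangent siota tD2.
  have t1 := tangentD tdD2 tII; have t2 := tangentB t1 tdW.
  rewrite (normal_partD hgt siota hA) // (normal_partD hgt siota hA) //; last exact: tangentN.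
  rewrite (normal_partD hgt siota hA) // (normal_partN hgt siota hA) //.
  rewrite !(normal_part_differential hgt siota hA) // nNC oppr0 addr0 add0r.
  by rewrite (normal_part_second_ff hgt hDt siota hA).
have tdX := differential_tangent siota tX; have tdY := differential_tangent siota tY.
have tdB := differential_tangent siota tB.
have sYZ := cov_smooth cDt eY.1 eZ.1; have sXZ := cov_smooth cDt eX.1 eZ.1.
have t1 := conn_tangent cDt tdX sYZ; have t2 := conn_tangent cDt tdY sXZ.
have t3 := conn_tangent cDt tdB eZ.1.
have -> : curvature Dt Xt Yt Zt P = Dt P (d p (X p)) (cov Dt Yt Zt)
    - Dt P (d p (Y p)) (cov Dt Xt Zt) - Dt P (d p (cov D X Y p - cov D Y X p)) Zt.
  rewrite /curvature -(levi_civita_torsion hD sX sY).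
  rewrite -(lie_bracket_related siota sX sY eX eY).
  by rewrite -(extends_at_value eX) -(extends_at_value eY).
rewrite (normal_partD hgt siota hA) //; [|exact: tangentB|exact: tangentN].
rewrite (normal_partD hgt siota hA) //; [|exact: tangentN].
rewrite !(normal_partN hgt siota hA) // (normal_second _ Y Yt) // (normal_second _ X Xt) //.
have -> : normal_part gt iota p (Dt P (d p (cov D X Y p - cov D Y X p)) Zt) =
    II p (cov D X Y p - cov D Y X p) (Z p).
  rewrite (gauss_formula hgt hDt siota hD hA tB sZ eZ).
  have tDB := conn_tangent cD tB sZ.
  rewrite (normal_partD hgt siota hA) ?(normal_part_differential hgt siota hA) // ?add0r.
  - by rewrite (normal_part_second_ff hgt hDt siota hA).
  - exact: differential_tangent.
  - exact: (second_ff_tangent hgt hDt siota hA).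
rewrite (second_ffBl hgt hDt siota hA) // /nablaB.
by vec_ring.
Qed.

(** The mean curvature vector has some given extension, unrelated to those of its
    summands II(E_i, E_i); the normal derivative does not see the difference. *)
Lemma normal_connection_sum (I : finType) (X Y : I -> vfield R M)
    (Xt Yt : I -> vfield R Mt) x (eta : vfield R Mt) (a : R) :
  tangent p x -> (forall i, smooth_field_at p (X i)) ->
  (forall i, smooth_field_at p (Y i)) -> (forall i, ext (X i) (Xt i)) ->
  (forall i, ext (Y i) (Yt i)) ->
  extends_at iota p eta (fun q => a *: \sum_i II q (X i q) (Y i q)) ->
  normal_part gt iota p (Dt P (d p x) eta) =
  a *: \sum_i NC x (fun q => II q (X i q) (Y i q)).
Proof.
move=> tx sX sY eX eY eeta; have tdx := differential_tangent siota tx.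
have en i := normal_extension_ext (sX i) (sY i) (eX i) (eY i).
pose S Q : vec R Mt := a *: \sum_i normal_extension (Xt i) (Yt i) Q.
have sS : smooth_field_at P S.
  apply: (smooth_fieldZ (f := fun=> a)); first exact: smooth_at_cst.
  by apply: smooth_field_sum => i; exact: (en i).1.
rewrite (ambient_conn_along hgt hDt siota hA (Z := S) tx eeta.1 sS); last first.
  have en' : \forall q \near p, forall i,
      normal_extension (Xt i) (Yt i) (iota q) = II q (X i q) (Y i q).
    by apply: near_forall_fin => i; exact: (en i).2.
  apply: filterS2 en' eeta.2 => q enq ->; rewrite /S; congr (_ *: _).
  by apply: eq_bigr => i _.
have tD i : tangent P (Dt P (d p x) (normal_extension (Xt i) (Yt i))).
  by apply: (conn_tangent cDt) => //; exact: (en i).1.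
rewrite /S (connZr cDt) //; last by apply: smooth_field_sum => i; exact: (en i).1.
rewrite (conn_sumr cDt) //; last by move=> i; exact: (en i).1.
rewrite (normal_partZ hgt siota hA); last exact: tangent_sum.
rewrite (normal_part_sum hgt siota hA) //; congr (_ *: _); apply: eq_bigr => i _.
by rewrite (normal_connection_second_ff tx (sX i) (sY i) (eX i) (eY i)).
Qed.

End SecondDerivatives.

(** * Traces over an adapted frame *)

Section Traces.
Context {R : realType} {n k : nat} {M : manifold R n} {Mt : manifold R (n + k)}.
Variables (gt : Mt -> vec R Mt -> vec R Mt -> R).
Variables (Dt : Mt -> vec R Mt -> vfield R Mt -> vec R Mt).
Variables (D : M -> vec R M -> vfield R M -> vec R M) (iota : M -> Mt).
Hypothesis hgt : riemannian_metric gt.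
Hypothesis hDt : levi_civita gt Dt.
Hypothesis siota : smooth_map iota.
Hypothesis hD : levi_civita (induced_metric gt iota) D.
Variables (E : 'I_n -> vfield R M) (Et : 'I_n -> vfield R Mt) (N : 'I_k -> vfield R Mt).
Variable p : M.
Hypothesis hA : adapted gt iota E Et N p.

Local Notation g := (induced_metric gt iota).
Local Notation d := (differential iota).
Local Notation II := (second_ff gt Dt iota).
Local Notation W := (weingarten gt Dt iota).
Local Notation P := (iota p).
Local Notation ext X Xt := (extends_at iota p Xt (fun q => d q (X q))).
Local Notation NC := (normal_connection gt Dt iota p).
Local Notation nabII := (nablaB gt Dt iota D II).

Let fgt := riemannian_sym_bilinear hgt.
Let fg : sym_bilinear g := induced_sym_bilinear siota fgt.
Let cDt := levi_civita_connection hDt.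
Let cD := levi_civita_connection hD.
Let sE := adapted_smooth_E hA.
Let sEt := adapted_smooth_Et hA.
Let sN := adapted_smooth_N hA.
Let eE := adapted_ext hA.
Let tE := adapted_tangent_E hA.
Let tN := adapted_tangent_N hA.
Let bE : on_basis g p (E ^~ p).
Proof. exact: nbhs_singleton hA.(adapted_frame).2. Qed.
Let tII x y : tangent p x -> tangent p y -> tangent P (II p x y).
Proof. by move=> tx ty; exact: (second_ff_tangent hgt hDt siota hA). Qed.

(** Parseval's identity in the normal space. *)
Lemma second_ff_metric x y z w : tangent p x -> tangent p y -> tangent p z ->
  tangent p w -> gt P (II p x y) (II p z w) =
  \sum_l gt P (N l P) (II p x y) * gt P (N l P) (II p z w).
Proof.
move=> tx ty tz tw; have t1 := tII tx ty; have t2 := tII tz tw.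
rewrite -{1}(normal_part_second_ff hgt hDt siota hA tx ty) (normal_partE hgt siota hA) //.
rewrite (metric_suml fgt) // => [|l]; last exact: tangentZ.
by apply: eq_bigr => l _; rewrite (metricZl fgt) // (fgt.1 _ _ _ t1).
Qed.

Lemma weingarten_adjoint eta x y : tangent P eta -> tangent p x -> tangent p y ->
  g p (W p eta x) y = gt P eta (II p x y).
Proof.
move=> te tx ty; rewrite (weingartenE hgt hDt siota hD hA) //.
rewrite (metric_suml fg) //; last by move=> i; exact: tangentZ.
rewrite {2}(on_basis_expand fg bE ty) (second_ff_combr hgt hDt siota hD hA) //.
rewrite (metric_sumr fgt) //; last by move=> i; apply: tangentZ; exact: tII.
apply: eq_bigr => i _; rewrite (metricZl fg) // (metricZr fgt) //; last exact: tII.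
by rewrite mulrC fg.1.
Qed.

(** Both sides have the component sum_{i,l} <N_l, II(E_i, x)> <N_l, II(E_i, E_j)>
    along E_j. *)
Lemma sum_weingarten_second_ff x : tangent p x ->
  \sum_i W p (II p (E i p) x) (E i p) = \sum_l W p (N l P) (W p (N l P) x).
Proof.
move=> tx.
have tW l : tangent p (W p (N l P) x).
  exact: (weingarten_tangent hgt hDt siota hD hA).
apply: (on_basis_ext fg bE).
- by apply: tangent_sum => i; apply: (weingarten_tangent hgt hDt siota hD hA) => //; exact: tII.
- by apply: tangent_sum => l; exact: (weingarten_tangent hgt hDt siota hD hA).
move=> j; rewrite !(metric_suml fg) //; last 2 first.
- by move=> l; exact: (weingarten_tangent hgt hDt siota hD hA).
- by move=> i; apply: (weingarten_tangent hgt hDt siota hD hA) => //; exact: tII.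
under eq_bigr => i _.
  rewrite weingarten_adjoint //; last exact: tII.
  rewrite second_ff_metric //.
  over.
rewrite exchange_big; apply: eq_bigr => l _ /=.
rewrite weingarten_adjoint //.
rewrite (on_basis_expand fg bE (tW l)) (second_ff_combl hgt hDt siota hA) //.
rewrite (metric_sumr fgt) //; last by move=> i; apply: tangentZ; exact: tII.
apply: eq_bigr => i _; rewrite (metricZr fgt) //; last exact: tII.
rewrite weingarten_adjoint //; congr (_ * _).
by rewrite (second_ff_sym hgt hDt siota hD hA).
Qed.

Variables (v : vfield R M) (vt : vfield R Mt).
Hypothesis sv : smooth_field_at p v.
Hypothesis ev : ext v vt.
Let tv : tangent p (v p) := smooth_field_tangent sv.

(** Sum second_derivative over the frame and split the first-order terms by
    Dt_{E_i} E_i = D_{E_i} E_i + II(E_i, E_i). *)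
Lemma sum_hess_tangential :
  \sum_i (cov Dt (Et i) (cov Dt (Et i) vt) P - cov Dt (cov Dt (Et i) (Et i)) vt P) =
  - d p (bochner_laplacian D E v p) - \sum_l d p (W p (N l P) (W p (N l P) (v p)))
  - \sum_i Dt P (II p (E i p) (E i p)) vt + tr_nablaB gt Dt iota D II E v p
  + 2%:R *: \sum_i II p (E i p) (cov D (E i) v p).
Proof.
have step i : cov Dt (Et i) (cov Dt (Et i) vt) P - cov Dt (cov Dt (Et i) (Et i)) vt P
    = d p (cov D (E i) (cov D (E i) v) p - cov D (cov D (E i) (E i)) v p)
      - d p (W p (II p (E i p) (v p)) (E i p))
      - Dt P (II p (E i p) (E i p)) vt + nabII (E i) (E i) v p
      + 2%:R *: II p (E i p) (cov D (E i) v p).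
  have tDE : tangent p (cov D (E i) (E i) p) by exact: cov_tangent.
  have tdDE := differential_tangent siota tDE.
  have -> : cov Dt (cov Dt (Et i) (Et i)) vt P =
      d p (cov D (cov D (E i) (E i)) v p) + II p (cov D (E i) (E i) p) (v p)
      + Dt P (II p (E i p) (E i p)) vt.
    rewrite -[LHS]/(Dt P (Dt P (Et i P) (Et i)) vt) (adapted_Et hA).
    rewrite (gauss_formula hgt hDt siota hD hA (tE i) (sE i) (eE i)).
    rewrite (connDl cDt) //; [|exact: tII|exact: ev.1].
    by rewrite (gauss_formula hgt hDt siota hD hA tDE sv ev).
  rewrite -[cov Dt (Et i) _ P]/(Dt P (Et i P) (cov Dt (Et i) vt)) (adapted_Et hA).
  rewrite (second_derivative hgt hDt siota hD hA (tE i) (sE i) sv (eE i) ev).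
  rewrite differentialB /nablaB -[D p (E i p) _]/(cov D (E i) (cov D (E i) v) p).
  by vec_ring.
have split (a b c e f : 'I_n -> vec R Mt) :
    \sum_i (a i - b i - c i + e i + 2%:R *: f i) =
    \sum_i a i - \sum_i b i - \sum_i c i + \sum_i e i + 2%:R *: \sum_i f i.
  by rewrite !big_split /= !sumrN -scaler_sumr.
rewrite (eq_bigr _ (fun i _ => step i)) split -!differential_sum.
by rewrite sum_weingarten_second_ff // /bochner_laplacian differentialN opprK.
Qed.

(** The connection form of an orthonormal frame is skew while II is symmetric. *)
Lemma sum_second_ff_conn x : tangent p x ->
  \sum_i II p (D p x (E i)) (E i p) = 0.
Proof.
move=> tx; have tDE i : tangent p (D p x (E i)) by exact: (conn_tangent cD).
pose om i j := g p (D p x (E i)) (E j p).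
have skew i j : om i j = - om j i.
  have := levi_civita_metric hD tx (sE i) (sE j).
  rewrite (tangent_near tx (f' := fun=> (i == j)%:R)).
  - rewrite (tangent_cst _ tx) => /esym/eqP; rewrite addr_eq0 => /eqP.
    by rewrite [g p (E i p) _]fg.1.
  - exact: (on_frame_coord_smooth fg hA.(adapted_frame) (sE i)).
  - by apply: filterS hA.(adapted_frame).2 => q [].
have S : \sum_i II p (D p x (E i)) (E i p) = \sum_i \sum_j om i j *: II p (E j p) (E i p).
  apply: eq_bigr => i _.
  by rewrite {1}(on_basis_expand fg bE (tDE i)) (second_ff_combl hgt hDt siota hA).
have : \sum_i \sum_j om i j *: II p (E j p) (E i p) =
    - \sum_i \sum_j om i j *: II p (E j p) (E i p).
  rewrite {1}exchange_big -sumrN; apply: eq_bigr => i _.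
  rewrite -sumrN; apply: eq_bigr => j _.
  by rewrite skew scaleNr (second_ff_sym hgt hDt siota hD hA).
rewrite S => /eqP; rewrite -subr_eq0 opprK -mulr2n -scaler_nat scaler_eq0.
by rewrite pnatr_eq0 => /eqP.
Qed.

(** The Codazzi equation moves the derivative in (nabla_{E_i} II)(v, E_i) to the
    direction v, where the trace of II commutes with it. *)
Lemma tr_nablaB_codazzi :
  tr_nablaB gt Dt iota D II E v p =
  \sum_i NC (v p) (fun q => II q (E i q) (E i q))
  + \sum_i normal_part gt iota p (curvature Dt (Et i) vt (Et i) P).
Proof.
have swap i : nabII (E i) (E i) v p = nabII (E i) v (E i) p.
  rewrite /nablaB; have sDE := cov_smooth cD (sE i) (sE i).
  have sDv := cov_smooth cD (sE i) sv.
  rewrite (normal_connection_second_ff hgt hDt siota hD hA (tE i) (sE i) sv (eE i) ev).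
  rewrite -(normal_connectionE hgt hDt siota hA (V := fun q => II q (v q) (E i q))) //.
    rewrite [II p (E i p) _](second_ff_sym hgt hDt siota hD hA) //.
      rewrite [II p _ (v p)](second_ff_sym hgt hDt siota hD hA) //.
        by vec_ring.
      exact: smooth_field_tangent.
    exact: smooth_field_tangent.
  have [sn en] := normal_extension_ext hgt hDt siota hD hA (sE i) sv (eE i) ev.
  split=> //; near=> q; have -> : normal_extension gt Dt N (Et i) vt (iota q) =
      II q (E i q) (v q) by near: q.
  have Aq : adapted gt iota E Et N q by near: q; exact: adapted_open.
  apply: (second_ff_sym hgt hDt siota hD Aq); first exact: (adapted_tangent_E Aq i).
  by near: q; exact: sv.1.
have cod i : normal_part gt iota p (curvature Dt (Et i) vt (Et i) P) =
    nabII (E i) v (E i) p - nabII v (E i) (E i) p.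
  exact: (codazzi hgt hDt siota hD hA).
have <- : \sum_i nabII v (E i) (E i) p = \sum_i NC (v p) (fun q => II q (E i q) (E i q)).
  have split (a b c : 'I_n -> vec R Mt) :
      \sum_i (a i - b i - c i) = \sum_i a i - \sum_i b i - \sum_i c i.
    by rewrite !sumrB.
  rewrite /nablaB split (sum_second_ff_conn tv) subr0.
  rewrite [X in _ - X](_ : _ = 0) ?subr0 // -[RHS](sum_second_ff_conn tv).
  apply: eq_bigr => i _; rewrite (second_ff_sym hgt hDt siota hD hA) //.
  exact: (conn_tangent cD).
rewrite /tr_nablaB -big_split; apply: eq_bigr => i _.
by rewrite /= swap cod [RHS]addrC subrK.
Unshelve. all: by end_near. Qed.

Lemma second_ff_trace r (e : 'I_r -> vec R M) : on_basis g p e ->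
  \sum_a II p (e a) (e a) = \sum_i II p (E i p) (E i p).
Proof.
move=> be; have [te _ _] := be.
rewrite -[RHS](on_basis_trace (q := p) (e := e) (e' := E ^~ p) fg
  (fun c b => II p (E c p) (E b p))) //.
apply: eq_bigr => a _; rewrite {2}(on_basis_expand fg bE (te a)).
rewrite (second_ff_combr hgt hDt siota hD hA) //; apply: eq_bigr => b _.
congr (_ *: _); rewrite {1}(on_basis_expand fg bE (te a)).
exact: (second_ff_combl hgt hDt siota hA).
Qed.

(** * Hypersurfaces *)

Variable l : 'I_k.
Hypothesis hl : forall l', l' = l.
Local Notation Nl := (N l).
Local Notation h := (scalar_ff gt Dt iota Nl).

Lemma sum_single (V : nmodType) (F : 'I_k -> V) : \sum_l' F l' = F l.
Proof. by rewrite (bigD1 l) //= big1 ?addr0 // => l'; rewrite (hl l') eqxx. Qed.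

Lemma hypersurface_normal_part z : tangent P z ->
  normal_part gt iota p z = gt P z (Nl P) *: Nl P.
Proof. by move=> tz; rewrite (normal_partE hgt siota hA) // sum_single. Qed.

Lemma hypersurface_second_ff x y : tangent p x -> tangent p y ->
  II p x y = h p x y *: Nl P.
Proof.
move=> tx ty; rewrite -{1}(normal_part_second_ff hgt hDt siota hA) //.
rewrite hypersurface_normal_part; last exact: tII.
by rewrite fgt.1 //; exact: tII.
Qed.

Lemma conn_unit_normal z : tangent P z -> (\forall Q \near P, gt Q (Nl Q) (Nl Q) = 1) ->
  gt P (Dt P z Nl) (Nl P) = 0.
Proof.
move=> tz N1; have := levi_civita_metric hDt tz (sN l) (sN l).
rewrite (tangent_near tz (f' := fun=> 1)) //; last exact: (riemannian_smooth hgt).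
have tD : tangent P (Dt P z Nl) by exact: (conn_tangent cDt).
rewrite (tangent_cst _ tz) [gt P (Nl P) _]fgt.1 //.
by move/esym/eqP; rewrite -mulr2n mulrn_eq0 => /eqP.
Qed.

Lemma ambient_unit_normal : \forall Q \near P, gt Q (Nl Q) (Nl Q) = 1.
Proof.
apply: filterS (adapted_ambient hA).2 => Q [_ /(_ (rshift n l) (rshift n l)) + _].
by rewrite /ambient_frame -[rshift n l]/(unsplit (inr l)) unsplitK eqxx.
Qed.

(** The unit normal of a hypersurface is parallel for the normal connection. *)
Lemma hypersurface_normal_connection x X Y Xt Yt : tangent p x ->
  smooth_field_at p X -> smooth_field_at p Y -> ext X Xt -> ext Y Yt ->
  NC x (fun q => II q (X q) (Y q)) = x (fun q => h q (X q) (Y q)) *: Nl P.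
Proof.
move=> tx sX sY eX eY; have tdx := differential_tangent siota tx.
rewrite (normal_connection_second_ff hgt hDt siota hD hA tx sX sY eX eY).
have [sn en] := normal_extension_ext hgt hDt siota hD hA sX sY eX eY.
have tD := conn_tangent cDt tdx sn.
rewrite hypersurface_normal_part //; congr (_ *: _).
have := levi_civita_metric hDt tdx (sN l) sn.
have sNn := riemannian_smooth hgt (sN l) sn.
rewrite differentialE // (tangent_near tx (f' := fun q => h q (X q) (Y q))).
- have tX := smooth_field_tangent sX; have tY := smooth_field_tangent sY.
  have tDN : tangent P (Dt P (d p x) Nl) by exact: (conn_tangent cDt).
  rewrite (nbhs_singleton en) hypersurface_second_ff // (metricZr fgt) //.
  rewrite (conn_unit_normal tdx ambient_unit_normal) mulr0 add0r => ->.
  by rewrite fgt.1.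
- exact: (smooth_at_iota siota sNn).
- by apply: filterS en => q ->.
Qed.

(** Since N has length 1 on a neighbourhood of p in the ambient manifold, Dt_N N is
    orthogonal to N, hence tangent to M. *)
Lemma hypersurface_conn_normal :
  cov Dt Nl Nl P = d p (tangential_part gt iota p (cov Dt Nl Nl P)).
Proof.
have tC : tangent P (cov Dt Nl Nl P) by exact: cov_tangent.
rewrite {1}[cov Dt Nl Nl P](ambient_decomp gt iota p) hypersurface_normal_part //.
by rewrite (conn_unit_normal (tN l) ambient_unit_normal) scale0r addr0.
Qed.

(** The sum of the eigenvalues of the shape operator is its trace, which may be
    computed in the frame E instead of an eigenbasis. *)
Lemma mean_curvature_trace H :
  is_mean_curvature g p (shape_operator gt Dt iota Nl p) H ->
  H = n%:R^-1 * \sum_i h p (E i p) (E i p).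
Proof.
move=> [e [kap [be se ->]]]; congr (_ * _); have [te ge _] := be.
have -> : \sum_i h p (E i p) (E i p) = gt P (Nl P) (\sum_i II p (E i p) (E i p)).
  by rewrite (metric_sumr fgt) // => i; exact: tII.
rewrite -(second_ff_trace be) (metric_sumr fgt) // => [|a]; last exact: tII.
apply: eq_bigr => a _; rewrite -weingarten_adjoint //.
rewrite -[W p _ _]/(shape_operator gt Dt iota Nl p (e a)) se (metricZl fg) //.
by rewrite ge eqxx mulr1.
Qed.

Lemma sum_principal_second_ff (kappa : 'I_n -> R) :
  (forall i, shape_operator gt Dt iota Nl p (E i p) = kappa i *: E i p) ->
  \sum_i II p (E i p) (cov D (E i) v p) =
  (\sum_i kappa i * cov_component g D E v p i i) *: Nl P.
Proof.
move=> sk; rewrite scaler_suml; apply: eq_bigr => i _.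
have tDv : tangent p (cov D (E i) v p) by exact: cov_tangent.
rewrite hypersurface_second_ff //; congr (_ *: _).
rewrite (cov_componentE fg hD _ _ (adapted_frame hA)) //.
rewrite -[LHS](weingarten_adjoint (tN l)) //.
rewrite -[W p _ _]/(shape_operator gt Dt iota Nl p (E i p)) sk (metricZl fg) //.
by rewrite fg.1.
Qed.

Lemma hypersurface_tr_nablaB :
  tr_nablaB gt Dt iota D II E v p = div_form D h E v p *: Nl P.
Proof.
rewrite /tr_nablaB /div_form scaler_suml; apply: eq_bigr => i _.
rewrite /nablaB (hypersurface_normal_connection (tE i) (sE i) sv (eE i) ev).
have t1 : tangent p (cov D (E i) (E i) p) by exact: cov_tangent.
have t2 : tangent p (cov D (E i) v p) by exact: cov_tangent.
by rewrite !hypersurface_second_ff // !scalerBl.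
Qed.

(** Skew-adjointness of the curvature operator annihilates the term along N in the
    trace Ric(v, N), and turns the others into - gt(R(E_i, v)E_i, N). *)
Lemma normal_part_ricci (Ft : 'I_(n + k) -> vfield R Mt) : on_frame gt P Ft ->
  normal_part gt iota p (sharp gt P (fun Y => ricci gt Dt Ft vt Y P)) =
  - \sum_i normal_part gt iota p (curvature Dt (Et i) vt (Et i) P).
Proof.
move=> fF; have svt := ev.1; have fG := adapted_ambient hA.
have gs := riemannian_smooth hgt; have spF := on_frame_spanned fF.
have [tS SE] := ricci_sharp fgt hDt gs fF svt.
rewrite hypersurface_normal_part // (SE _ (sN l)).
rewrite (ricci_frame fgt hDt fF fG svt (sN l)) /ricci big_split_ord /= sum_single.
rewrite /ambient_frame -[rshift n l]/(unsplit (inr l)) unsplitK.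
have tCN : tangent P (curvature Dt Nl vt Nl P) by exact: (curvature_tangent hDt).
have -> : gt P (curvature Dt Nl vt Nl P) (Nl P) = 0.
  have := curvature_skew fgt hDt gs spF (sN l) svt (sN l) (sN l).
  rewrite [gt P (Nl P) _]fgt.1 // => /eqP.
  by rewrite -subr_eq0 opprK -mulr2n mulrn_eq0 => /eqP.
rewrite addr0 -sumrN scaler_suml; apply: eq_bigr => i _.
rewrite -[lshift k i]/(unsplit (inl i)) unsplitK.
have tC : tangent P (curvature Dt (Et i) vt (Et i) P) by exact: (curvature_tangent hDt).
rewrite hypersurface_normal_part // -scaleNr; congr (_ *: _).
rewrite (curvature_skew fgt hDt gs spF (sEt i) svt (sN l) (sEt i)).
by rewrite fgt.1.
Qed.

End Traces.

(** * The Bochner Laplacians of a submanifold and of the ambient manifold *)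

Theorem theorem1p1 (R : realType) (n k : nat) (hn : (2 <= n)%N) (hk : (1 <= k)%N)
  (Mt : manifold R (n + k)) (gt : Mt -> vec R Mt -> vec R Mt -> R)
  (Dt : Mt -> vec R Mt -> vfield R Mt -> vec R Mt)
  (hgt : riemannian_metric gt) (hDt : levi_civita gt Dt)
  (M : manifold R n) (iota : M -> Mt) (hiota : embedding iota)
  (D : M -> vec R M -> vfield R M -> vec R M)
  (hD : levi_civita (induced_metric gt iota) D)
  (v : vfield R M) (hv : forall q, smooth_field_at q v) (p : M)
  (vt : vfield R Mt)
  (hvt : extends_at iota p vt (fun q => differential iota q (v q)))
  (E : 'I_n -> vfield R M) (hE : on_frame (induced_metric gt iota) p E)
  (Et : 'I_n -> vfield R Mt)
  (hEt : forall i, extends_at iota p (Et i) (fun q => differential iota q (E i q)))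
  (N : 'I_k -> vfield R Mt)
  (hN : \forall q \near p, on_normal_basis gt iota q (fun l => N l (iota q)))
  (hEN : on_frame gt (iota p)
     (fun a : 'I_(n + k) => match fintype.split a with inl i => Et i | inr l => N l end))
  (Ht : vfield R Mt)
  (hHt : extends_at iota p Ht (mean_curvature_vector gt Dt iota E))
  (F : 'I_n -> vfield R M) (hF : on_frame (induced_metric gt iota) p F)
  (Ft : 'I_(n + k) -> vfield R Mt) (hFt : on_frame gt (iota p) Ft) :
  let d := differential iota p in
  let II := second_ff gt Dt iota in
  let W := weingarten gt Dt iota p in
  let Hvec := mean_curvature_vector gt Dt iota E p in
  [/\ bochner_laplacian Dt Ft vt (iota p)
      = d (bochner_laplacian D F v p)
        + \sum_l d (W (N l (iota p)) (W (N l (iota p)) (v p)))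
        - n%:R *: d (W Hvec (v p))
        + n%:R *: lie_bracket Ht vt (iota p)
        - \sum_l cov Dt (N l) (cov Dt (N l) vt) (iota p)
        + \sum_l cov Dt (cov Dt (N l) (N l)) vt (iota p)
        - 2%:R *: \sum_i II p (E i p) (cov D (E i) v p)
        - \sum_i normal_part gt iota p (curvature Dt (Et i) vt (Et i) (iota p)),
      bochner_laplacian Dt Ft vt (iota p)
      = d (bochner_laplacian D F v p)
        + \sum_l d (W (N l (iota p)) (W (N l (iota p)) (v p)))
        + n%:R *: Dt (iota p) Hvec vt
        - \sum_l cov Dt (N l) (cov Dt (N l) vt) (iota p)
        + \sum_l cov Dt (cov Dt (N l) (N l)) vt (iota p)
        - tr_nablaB gt Dt iota D II E v p
        - 2%:R *: \sum_i II p (E i p) (cov D (E i) v p) &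
      k = 1%N ->
      forall (l : 'I_k) (kappa : 'I_n -> R) (H : M -> R),
      let h := scalar_ff gt Dt iota (N l) in
      let s := shape_operator gt Dt iota (N l) in
      let NN := tangential_part gt iota p (cov Dt (N l) (N l) (iota p)) in
      let nabla := cov_component (induced_metric gt iota) D E v p in
      (forall i, s p (E i p) = kappa i *: E i p) ->
      (\forall q \near p,
         is_mean_curvature (induced_metric gt iota) q (s q) (H q)) ->
      bochner_laplacian Dt Ft vt (iota p)
      = d (bochner_laplacian D F v p) + d (s p (s p (v p)))
        + (n%:R * H p) *: cov Dt (N l) vt (iota p)
        - cov Dt (N l) (cov Dt (N l) vt) (iota p)
        + d (D p NN v)
        - (2%:R * (\sum_i kappa i * nabla i i) + n%:R * v p H - h p NN (v p))
            *: N l (iota p)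
        + normal_part gt iota p
            (sharp gt (iota p) (fun Y => ricci gt Dt Ft vt Y (iota p)))
      /\
      bochner_laplacian Dt Ft vt (iota p)
      = d (bochner_laplacian D F v p) + d (s p (s p (v p)))
        + (n%:R * H p) *: cov Dt (N l) vt (iota p)
        - cov Dt (N l) (cov Dt (N l) vt) (iota p)
        + d (D p NN v)
        - (div_form D h E v p + 2%:R * (\sum_i kappa i * nabla i i)
           - h p NN (v p)) *: N l (iota p)].

Proof.
have siota : smooth_map iota by case: hiota.
have hA : adapted gt iota E Et N p by split.
have cDt := levi_civita_connection hDt; have cD := levi_civita_connection hD.
have fgt := riemannian_sym_bilinear hgt.
have fg := induced_sym_bilinear siota fgt.
have sv := hv p; have svt := hvt.1.
have tv := smooth_field_tangent sv; have tdv := differential_tangent siota tv.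
have tE := adapted_tangent_E hA; have tN := adapted_tangent_N hA.
have tII x y : tangent p x -> tangent p y -> tangent (iota p) (second_ff gt Dt iota p x y).
  by move=> tx ty; exact: (second_ff_tangent hgt hDt siota hA).
have n0 : n%:R != 0 :> R by rewrite pnatr_eq0 -lt0n; exact: leq_trans hn.
move=> d II W Hvec.
have nHvec : n%:R *: Hvec = \sum_i II p (E i p) (E i p).
  by rewrite /Hvec /mean_curvature_vector scalerA divff // scale1r.
have tHvec : tangent (iota p) Hvec.
  by apply: tangentZ; apply: tangent_sum => i; exact: tII.
have sum_conn_II : \sum_i Dt (iota p) (II p (E i p) (E i p)) vt = n%:R *: Dt (iota p) Hvec vt.
  by rewrite -(connZl cDt) // nHvec (conn_suml cDt) // => i; exact: tII.
(* The second formula comes first: the three others are rewritings of it. *)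
have formula2 : bochner_laplacian Dt Ft vt (iota p)
    = d (bochner_laplacian D F v p)
      + \sum_l d (W (N l (iota p)) (W (N l (iota p)) (v p)))
      + n%:R *: Dt (iota p) Hvec vt
      - \sum_l cov Dt (N l) (cov Dt (N l) vt) (iota p)
      + \sum_l cov Dt (cov Dt (N l) (N l)) vt (iota p)
      - tr_nablaB gt Dt iota D II E v p
      - 2%:R *: \sum_i II p (E i p) (cov D (E i) v p).
  (* The frames Ft and F are replaced by the adapted one and by E. *)
  rewrite (bochner_laplacian_frame cDt fgt hFt (adapted_ambient hA) svt).
  rewrite (bochner_laplacian_frame cD fg hF hE sv).
  have -> : bochner_laplacian Dt (ambient_frame Et N) vt (iota p) =
      - (\sum_i (cov Dt (Et i) (cov Dt (Et i) vt) (iota p)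
               - cov Dt (cov Dt (Et i) (Et i)) vt (iota p))
         + \sum_l (cov Dt (N l) (cov Dt (N l) vt) (iota p)
               - cov Dt (cov Dt (N l) (N l)) vt (iota p))).
    rewrite /bochner_laplacian big_split_ord; congr (- (_ + _)).
      apply: eq_bigr => i _; rewrite /ambient_frame.
      by rewrite -[lshift k i]/(unsplit (inl i)) unsplitK.
    apply: eq_bigr => l _; rewrite /ambient_frame.
    by rewrite -[rshift n l]/(unsplit (inr l)) unsplitK.
  rewrite [\sum_(l < k) _]sumrB (sum_hess_tangential hgt hDt siota hD hA sv hvt) sum_conn_II.
  rewrite -/d -/II -/W.
  by vec_ring.
have tr_codazzi := tr_nablaB_codazzi hgt hDt siota hD hA sv hvt.
split=> //.
- have conn_H : normal_part gt iota p (Dt (iota p) (d (v p)) Ht) =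
      n%:R^-1 *: \sum_i normal_connection gt Dt iota p (v p)
        (fun q => II q (E i q) (E i q)).
    by apply: (normal_connection_sum hgt hDt siota hD hA tv) => //;
      exact: adapted_smooth_E hA.
  have HtE : Ht (iota p) = Hvec by exact: extends_at_value hHt.
  (* The Weingarten term of Dt_v H is cancelled by - n W_H v. *)
  have -> : n%:R *: lie_bracket Ht vt (iota p) = n%:R *: Dt (iota p) Hvec vt
      + n%:R *: d (W Hvec (v p))
      - \sum_i normal_connection gt Dt iota p (v p) (fun q => II q (E i q) (E i q)).
    rewrite (levi_civita_torsion hDt hHt.1 svt) /cov HtE (extends_at_value hvt).
    rewrite (weingarten_formula hgt hDt siota hD hA hHt.1 tv); last first.
      near=> q => y ty; have -> : Ht (iota q) = mean_curvature_vector gt Dt iota E q.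
        by near: q; exact: hHt.2.
      have Aq : adapted gt iota E Et N q by near: q; exact: adapted_open.
      have tEq := adapted_tangent_E Aq.
      have tIIq i := second_ff_tangent hgt hDt siota Aq (tEq i) (tEq i).
      have tdy := differential_tangent siota ty.
      rewrite /mean_curvature_vector (metricZl fgt) //; last exact: tangent_sum.
      rewrite (metric_suml fgt) // big1 ?mulr0 // => i _.
      exact: (second_ff_orth hgt hDt siota Aq).
    rewrite conn_H HtE scalerBr scalerDr scalerA divff // scale1r scalerN.
    by rewrite opprD opprK addrA.
  rewrite formula2 tr_codazzi.
  by vec_ring.
move=> k1; subst k => l kappa H h s NN nabla sk nH.
have hl l' : l' = l by rewrite (ord1 l') (ord1 l).
have single (V : nmodType) (G : 'I_1 -> V) : \sum_l' G l' = G l by exact: sum_single.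
have tNN : tangent p NN.
  apply: (tangential_part_tangent hgt siota hA).
  by apply: (cov_tangent cDt); exact: adapted_smooth_N hA l.
(* The hypothesis on H is read near p because v differentiates H below. *)
have nearH : \forall q \near p, H q = n%:R^-1 * \sum_i h q (E i q) (E i q).
  have nA := adapted_open siota hA.
  apply: filterS2 nH nA => q Hq Aq.
  exact: (mean_curvature_trace hgt hDt siota hD Aq).
have hII x y : tangent p x -> tangent p y -> II p x y = h p x y *: N l (iota p).
  exact: (hypersurface_second_ff hgt hDt siota hA hl).
have HvecE : n%:R *: Dt (iota p) Hvec vt = (n%:R * H p) *: cov Dt (N l) vt (iota p).
  rewrite (nbhs_singleton nearH) mulrA divff // mul1r /cov -!(connZl cDt) //.
  rewrite nHvec scaler_suml; congr (Dt _ _ _).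
  by apply: eq_bigr => i _; exact: hII.
have connNN : cov Dt (cov Dt (N l) (N l)) vt (iota p) =
    d (D p NN v) + h p NN (v p) *: N l (iota p).
  rewrite -[LHS]/(Dt (iota p) (cov Dt (N l) (N l) (iota p)) vt).
  rewrite (hypersurface_conn_normal hgt hDt siota hA hl).
  by rewrite (gauss_formula hgt hDt siota hD hA tNN sv hvt) -hII.
have principal := sum_principal_second_ff hgt hDt siota hD hA sv hl sk.
have nvH : \sum_i normal_connection gt Dt iota p (v p) (fun q => II q (E i q) (E i q)) =
    (n%:R * v p H) *: N l (iota p).
  have sh i : smooth_at p (fun q => h q (E i q) (E i q)).
    have sEi := adapted_smooth_E hA i.
    have [sn en] := normal_extension_ext hgt hDt siota hD hA sEi sEi
      (adapted_ext hA i) (adapted_ext hA i).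
    have := smooth_at_iota siota (riemannian_smooth hgt (adapted_smooth_N hA l) sn).
    by apply: smooth_at_near; apply: filterS en => q ->.
  have -> : v p H = n%:R^-1 * \sum_i v p (fun q => h q (E i q) (E i q)).
    rewrite -(tangent_sumf _ tv) // -(tangent_scale _ tv); last exact: smooth_at_sum.
    apply/esym; apply: (tangent_near tv); last by apply: filterS nearH => q ->.
    by apply: smooth_atM; [exact: smooth_at_cst|exact: smooth_at_sum].
  rewrite mulrA divff // mul1r scaler_suml; apply: eq_bigr => i _.
  have sEi := adapted_smooth_E hA i; have eEi := adapted_ext hA i.
  exact: (hypersurface_normal_connection hgt hDt siota hD hA hl tv sEi sEi eEi eEi).
split; rewrite formula2 !single HvecE connNN principal.
- rewrite tr_codazzi nvH (normal_part_ricci hgt hDt siota hA hvt hl hFt).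
  by vec_ring.
- rewrite (hypersurface_tr_nablaB hgt hDt siota hD hA sv hvt hl).
  by vec_ring.
Unshelve. all: by end_near. Qed.
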